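(* Let $(M,\eta,H)$ be a contact Hamiltonian system and let $G$ be a Lie group with Lie algebra $\mathfrak{g}$ acting freely and properly by contactomorphisms on $(M,\eta)$ such that $H$ is $G$-invariant (that is, $H\circ g=H$ for all $g\in G$). Let $J:M\to\mathfrak{g}^*$ be the moment map, let $\mu\in\mathfrak{g}^*$ be a regular value of $J$ which is a fixed point of $G$ under the coadjoint action, let $M_\mu=J^{-1}(\mu)/G$, let $\pi_\mu:J^{-1}(\mu)\to M_\mu$ be the canonical projection and $\iota_\mu:J^{-1}(\mu)\to M$ the inclusion, and let $\eta_\mu$ be the unique contact form on $M_\mu$ with $\pi_\mu^*\eta_\mu=\iota_\mu^*\eta$. Then $(M_\mu,\eta_\mu,H_\mu)$ is a contact Hamiltonian system, where $H_\mu:M_\mu\to\mathbb{R}$ is the projection of $H$ by the action of $G$, i.e. $H_\mu\circ\pi_\mu=H\circ\iota_\mu$. Furthermore, $$(\pi_\mu)_*\left(X_H|_{J^{-1}(\mu)}\right)=X_{H_\mu}.$$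
   Context: A contact manifold $(M,\eta)$ is a $(2n+1)$-dimensional manifold $M$ with a $1$-form $\eta$ (contact form) such that $\eta\wedge(d\eta)^n$ is nowhere zero. The Reeb vector field $\mathcal{R}$ is the unique vector field with $\iota_{\mathcal{R}}\eta=1$, $\iota_{\mathcal{R}}d\eta=0$. A contact Hamiltonian system is a triple $(M,\eta,H)$ with $(M,\eta)$ a contact manifold and $H\in C^\infty(M)$. The Hamiltonian vector field $X_H$ is the unique vector field with $$\iota_{X_H}d\eta+\eta(X_H)\eta=dH-(\mathcal{R}(H)+H)\eta.$$ On $M_\mu$, $X_{H_\mu}$ is defined in the same way using $\eta_\mu$. $G$ acts by contactomorphisms if $g^*\eta=\eta$ for all $g\in G$. For $\xi\in\mathfrak{g}$, $\xi_M(x)=\frac{d}{dt}\big|_{t=0}(\exp(t\xi)\cdot x)$. The moment map $J:M\to\mathfrak{g}^*$ is $J(x)(\xi)=-\eta(\xi_M(x))$. The coadjoint action of $g\in G$ on $\mathfrak{g}^*$ is $\mathrm{Ad}^*_{g^{-1}}$, where $\mathrm{Ad}_g^*(\alpha)(\xi)=\alpha(\mathrm{Ad}_g\xi)$. The existence and uniqueness of the contact form $\eta_\mu$ on $M_\mu$ with $\pi_\mu^*\eta_\mu=\iota_\mu^*\eta$ is part of the setting. *)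

(* Defs.v *)
(* MathComp-Analysis; smooth manifolds, Lie groups and contact forms are built
   here on top of its topology and its derivatives. *)
From HB Require Import structures.
From mathcomp Require Import all_boot all_order all_algebra perm.
From mathcomp Require Import generic_quotient.
From mathcomp Require Import all_classical all_reals topology normedtype derive.

Set Implicit Arguments.
Unset Strict Implicit.
Unset Printing Implicit Defensive.
Import Order.TTheory GRing.Theory Num.Theory.
Import numFieldNormedType.Exports.
Local Open Scope quotient_scope.
Local Open Scope classical_set_scope.
Local Open Scope ring_scope.

(* C^k on an open set U, by iterating directional derivatives; meant for
   finite-dimensional V, where this is the usual notion. *)
Fixpoint Ck_on (R : realType) (V W : normedModType R) (k : nat)
    (U : set V) (f : V -> W) : Prop :=
  match k with
  | 0 => forall x, U x -> {for x, continuous f}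
  | k'.+1 => (forall x, U x -> differentiable f x) /\
             forall v : V, Ck_on k' U (fun x => 'D_v f x : W)
  end.

Definition smooth_on (R : realType) (V W : normedModType R)
  (U : set V) (f : V -> W) : Prop := forall k, Ck_on k U f.

Section Manifolds.
Variable R : realType.

(* [cmap] and [cinv] are total functions; only their values on [cdom] and
   [ccod] are meaningful. *)
Record chart (n : nat) (T : topologicalType) := Chart {
  cdom : set T;
  ccod : set 'rV[R]_n;
  cmap : T -> 'rV[R]_n;
  cinv : 'rV[R]_n -> T;
  cdom_open : open cdom;
  ccod_open : open ccod;
  cmap_cod : forall x, cdom x -> ccod (cmap x);
  cinv_dom : forall y, ccod y -> cdom (cinv y);
  cmapK : forall x, cdom x -> cinv (cmap x) = x;
  cinvK : forall y, ccod y -> cmap (cinv y) = y;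
  cmap_continuous : forall x, cdom x -> {for x, continuous cmap};
  cinv_continuous : forall y, ccod y -> {for y, continuous cinv} }.

(* An n-dimensional smooth manifold structure on T. The structure is given by
   an atlas indexed by the points of T, the chart of index x being a chart
   around x; every smooth structure has such an atlas.

   The tangent space at x is 'rV_n: the vector v stands for the tangent vector
   at x whose coordinates in the chart [chart_at x] are v. *)
Record manifold_on (n : nat) (T : topologicalType) := Manifold {
  chart_at : T -> chart n T;
  chart_at_dom : forall x, cdom (chart_at x) x;
  chart_at_compat : forall p q,
    smooth_on (ccod (chart_at p) `&`
               [set y | cdom (chart_at q) (cinv (chart_at p) y)])
              (cmap (chart_at q) \o cinv (chart_at p));
  manifold_hausdorff : hausdorff_space T;
  manifold_second_countable : @second_countable T }.

Section SmoothMaps.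
Variables (n1 n2 n3 : nat) (T1 T2 T3 : topologicalType).
Variables (S1 : manifold_on n1 T1) (S2 : manifold_on n2 T2).
Variable (S3 : manifold_on n3 T3).

Definition smooth_fun (f : T1 -> R) : Prop :=
  forall p, smooth_on (ccod (chart_at S1 p)) (f \o cinv (chart_at S1 p)).

Definition smooth_map (f : T1 -> T2) : Prop :=
  continuous f /\
  forall p q,
    smooth_on (ccod (chart_at S1 p) `&`
               [set y | cdom (chart_at S2 q) (f (cinv (chart_at S1 p) y))])
              (cmap (chart_at S2 q) \o f \o cinv (chart_at S1 p)).

(* smoothness of (x, y) |-> f x y on the product manifold T1 * T2 *)
Definition smooth_map2 (f : T1 -> T2 -> T3) : Prop :=
  continuous (fun xy : T1 * T2 => f xy.1 xy.2) /\
  forall p q r,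
    let g (y : 'rV[R]_n1 * 'rV[R]_n2) :=
      f (cinv (chart_at S1 p) y.1) (cinv (chart_at S2 q) y.2) in
    smooth_on [set y | [/\ ccod (chart_at S1 p) y.1, ccod (chart_at S2 q) y.2 &
                           cdom (chart_at S3 r) (g y)]]
              (cmap (chart_at S3 r) \o g).

Definition smooth_curve (c : R -> T1) : Prop :=
  continuous c /\
  forall p, smooth_on (c @^-1` cdom (chart_at S1 p)) (cmap (chart_at S1 p) \o c).

(* c'(t), a tangent vector at c t *)
Definition velocity (c : R -> T1) (t : R) : 'rV[R]_n1 :=
  'D_1 (cmap (chart_at S1 (c t)) \o c) t.

(* df_x (v), for f real-valued *)
Definition fdiff (f : T1 -> R) (x : T1) (v : 'rV[R]_n1) : R :=
  'D_v (f \o cinv (chart_at S1 x)) (cmap (chart_at S1 x) x).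

(* T_x f (v), a tangent vector at f x *)
Definition mdiff (f : T1 -> T2) (x : T1) (v : 'rV[R]_n1) : 'rV[R]_n2 :=
  'D_v (cmap (chart_at S2 (f x)) \o f \o cinv (chart_at S1 x))
       (cmap (chart_at S1 x) x).

Definition immersion (f : T1 -> T2) : Prop :=
  smooth_map f /\ forall x, injective (mdiff f x).

Definition submersion (f : T1 -> T2) : Prop :=
  smooth_map f /\ forall x w, exists v, mdiff f x v = w.

End SmoothMaps.

Section Fields.
Variables (n : nat) (T : topologicalType) (S : manifold_on n T).

(* the coordinates in the chart of index p of a vector field X *)
Definition vfield_in (X : T -> 'rV[R]_n) (p : T) (y : 'rV[R]_n) : 'rV[R]_n :=
  let x := cinv (chart_at S p) y in
  'D_(X x) (cmap (chart_at S p) \o cinv (chart_at S x)) (cmap (chart_at S x) x).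

Definition smooth_vfield (X : T -> 'rV[R]_n) : Prop :=
  forall p, smooth_on (ccod (chart_at S p)) (vfield_in X p).

(* the value of a 1-form eta on the coordinate vector field of the chart of
   index p in the direction v *)
Definition form_in (eta : T -> {scalar 'rV[R]_n}) (p : T) (v y : 'rV[R]_n) : R :=
  let x := cinv (chart_at S p) y in
  eta x ('D_v (cmap (chart_at S x) \o cinv (chart_at S p)) y).

Definition smooth_form (eta : T -> {scalar 'rV[R]_n}) : Prop :=
  forall p v, smooth_on (ccod (chart_at S p)) (form_in eta p v).

(* (d eta)_x (u, v) = D_u (eta v) - D_v (eta u), with u and v extended as
   constant vector fields in the chart around x, so that their bracket
   vanishes *)
Definition ext_d (eta : T -> {scalar 'rV[R]_n}) (x : T) (u v : 'rV[R]_n) : R :=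
  'D_u (form_in eta x v) (cmap (chart_at S x) x)
  - 'D_v (form_in eta x u) (cmap (chart_at S x) x).

End Fields.

Section Contact.
Variables (n : nat) (T : topologicalType) (S : manifold_on n.*2.+1 T).
Notation vect := 'rV[R]_(n.*2.+1).

(* (eta /\ (d eta)^n)_x (v_0, ..., v_2n), up to the factor 2^-n coming from the
   antisymmetry of d eta *)
Definition contact_volume (eta : T -> {scalar vect}) (x : T)
    (v : 'I_(n.*2.+1) -> vect) : R :=
  \sum_(s : 'S_(n.*2.+1))
    (-1) ^+ s * eta x (v (s ord0)) *
    \prod_(i < n) ext_d S eta x (v (s (inord i.*2.+1))) (v (s (inord i.*2.+2))).

Definition contact_form (eta : T -> {scalar vect}) : Prop :=
  smooth_form S eta /\ forall x, exists v, contact_volume eta x v != 0.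

Definition contact_hamiltonian_system (eta : T -> {scalar vect}) (H : T -> R) :=
  contact_form eta /\ smooth_fun S H.

Definition reeb_field (eta : T -> {scalar vect}) (Rb : T -> vect) : Prop :=
  [/\ smooth_vfield S Rb,
      forall x, eta x (Rb x) = 1 &
      forall x v, ext_d S eta x (Rb x) v = 0].

Definition hamiltonian_field (eta : T -> {scalar vect}) (H : T -> R)
    (X : T -> vect) : Prop :=
  smooth_vfield S X /\
  exists2 Rb, reeb_field eta Rb &
    forall x v,
      ext_d S eta x (X x) v + eta x (X x) * eta x v
      = fdiff S H x v - (fdiff S H x (Rb x) + H x) * eta x v.

End Contact.

Record lieGroup (d : nat) := LieGroup {
  lg_sort :> topologicalType;
  lg_manifold : manifold_on d lg_sort;
  lg_one : lg_sort;
  lg_inv : lg_sort -> lg_sort;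
  lg_mul : lg_sort -> lg_sort -> lg_sort;
  lg_mulA : associative lg_mul;
  lg_mul1g : left_id lg_one lg_mul;
  lg_mulVg : left_inverse lg_one lg_inv lg_mul;
  lg_inv_smooth : smooth_map lg_manifold lg_manifold lg_inv;
  lg_mul_smooth : smooth_map2 lg_manifold lg_manifold lg_manifold lg_mul }.

(* The Lie algebra of G is its tangent space at the identity, 'rV_d; its dual
   consists of the linear forms on 'rV_d. *)
Section LieGroups.
Variables (d : nat) (G : lieGroup d).
Notation SG := (lg_manifold G).

Definition one_parameter_subgroup (xi : 'rV[R]_d) (c : R -> G) : Prop :=
  [/\ smooth_curve SG c, forall s t, c (s + t) = lg_mul (c s) (c t) &
      velocity SG c 0 = xi].

(* The one-parameter subgroup with velocity xi exists and is unique, so the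
   default value is never used. *)
Definition lie_exp (xi : 'rV[R]_d) : G :=
  xget (lg_one G) [set g | exists2 c, one_parameter_subgroup xi c & c 1 = g].

Definition Ad (g : G) (xi : 'rV[R]_d) : 'rV[R]_d :=
  mdiff SG SG (fun h => lg_mul (lg_mul g h) (lg_inv g)) (lg_one G) xi.

(* the coadjoint action Ad^*_(g^-1) *)
Definition coadjoint (g : G) (alpha : 'rV[R]_d -> R) : 'rV[R]_d -> R :=
  fun xi => alpha (Ad (lg_inv g) xi).

End LieGroups.

Section Actions.
Variables (d n : nat) (G : lieGroup d) (T : topologicalType).
Variable (S : manifold_on n T).

Record smooth_action := SmoothAction {
  act : G -> T -> T;
  act1 : forall x, act (lg_one G) x = x;
  actM : forall g h x, act (lg_mul g h) x = act g (act h x);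
  act_smooth : smooth_map2 (lg_manifold G) S S act }.

Variable a : smooth_action.

Definition free_action : Prop := forall g x, act a g x = x -> g = lg_one G.

Definition proper_action : Prop :=
  forall K : set (T * T), compact K ->
    compact [set gx : G * T | K (act a gx.1 gx.2, gx.2)].

(* g^* eta = eta for all g *)
Definition by_contactomorphisms (eta : T -> {scalar 'rV[R]_n}) : Prop :=
  forall g x v, eta (act a g x) (mdiff S S (act a g) x v) = eta x v.

(* xi_M (x) *)
Definition inf_generator (xi : 'rV[R]_d) (x : T) : 'rV[R]_n :=
  velocity S (fun t => act a (lie_exp G (t *: xi)) x) 0.

(* J(x) is a linear form on the Lie algebra; linearity is not recorded in the
   type. *)
Definition moment_map (eta : T -> {scalar 'rV[R]_n}) (x : T) : 'rV[R]_d -> R :=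
  fun xi => - eta x (inf_generator xi x).

(* T_x J : T_x M -> g^* is onto whenever J x = mu *)
Definition regular_value (J : T -> 'rV[R]_d -> R) (mu : {scalar 'rV[R]_d}) :=
  forall x, J x = mu -> forall alpha : {scalar 'rV[R]_d},
    exists v, forall xi, fdiff S (J ^~ xi) x v = alpha xi.

Definition orbit_rel (A : set T) : rel A :=
  fun x y => `[< exists g, act a g (set_val x) = set_val y >].

Lemma orbit_rel_refl (A : set T) : reflexive (@orbit_rel A).
Proof. by move=> x; apply/asboolP; exists (lg_one G); exact: act1. Qed.

Lemma orbit_rel_sym (A : set T) : symmetric (@orbit_rel A).
Proof.
have E x y : @orbit_rel A x y -> @orbit_rel A y x.
  move=> /asboolP[g gxy]; apply/asboolP; exists (lg_inv g).
  by rewrite -gxy -actM lg_mulVg act1.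
by move=> x y; apply/idP/idP; exact: E.
Qed.

Lemma orbit_rel_trans (A : set T) : transitive (@orbit_rel A).
Proof.
move=> y x z /asboolP[g gxy] /asboolP[h hyz]; apply/asboolP.
by exists (lg_mul h g); rewrite actM gxy.
Qed.

Definition orbit_equiv (A : set T) : equiv_rel A :=
  EquivRel _ (@orbit_rel_refl A) (@orbit_rel_sym A) (@orbit_rel_trans A).

(* A / G with the quotient topology, A having the subspace topology *)
Definition orbit_space (A : set T) : topologicalType :=
  quotient_topology {eq_quot (orbit_equiv A)}.

Definition orbit_proj (A : set T) : A -> orbit_space A :=
  \pi_(quotient_topology {eq_quot (orbit_equiv A)}).

(* J^-1(mu), J^-1(mu) / G and the projection between them *)
Definition moment_level (eta : T -> {scalar 'rV[R]_n})
    (mu : {scalar 'rV[R]_d}) : set T :=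
  [set x | moment_map eta x = mu].

Definition reduced_space (eta : T -> {scalar 'rV[R]_n})
    (mu : {scalar 'rV[R]_d}) : topologicalType :=
  orbit_space (moment_level eta mu).

Definition reduced_proj (eta : T -> {scalar 'rV[R]_n})
    (mu : {scalar 'rV[R]_d}) : moment_level eta mu -> reduced_space eta mu :=
  @orbit_proj (moment_level eta mu).

End Actions.

End Manifolds.

Arguments moment_level {R d n G T S} a eta mu.
Arguments reduced_space {R d n G T S} a eta mu.
Arguments reduced_proj {R d n G T S} a eta mu _.

(* Main.v *)
(* The existence of eta_mu forces mu = 0: if x is in J^-1(mu) then xi_M(x) is tangent
   to J^-1(mu) and killed by T pi, hence mu(xi) = - eta(xi_M(x)) = 0. Since the action
   preserves eta, Cartan's formula reads d J_xi = iota_{xi_M} (d eta), and so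
   d J_xi (X_H) = - d eta (X_H, xi_M) = - dH(xi_M) + R(H) eta(xi_M) = 0: the field X_H
   is tangent to J^-1(mu), whose tangent space is the kernel of dJ by a dimension
   count. With iota^* eta = pi^* eta_mu, the projection of X_H satisfies the equations
   that determine X_{H_mu}, and the nondegeneracy of eta_mu concludes. H_mu is smooth
   because smoothness descends along submersions. *)
Require Import Defs.
From HB Require Import structures.
From mathcomp Require Import all_boot all_order all_algebra perm.
From mathcomp Require Import generic_quotient.
From mathcomp Require Import all_classical all_reals topology normedtype derive.
From mathcomp Require Import interval_inference landau sequences ring lra.

Set Implicit Arguments.
Unset Strict Implicit.
Unset Printing Implicit Defensive.
Import Order.TTheory GRing.Theory Num.Theory.
Import numFieldNormedType.Exports.
Local Open Scope classical_set_scope.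
Local Open Scope ring_scope.

(** Tangent vectors at x are coordinates in [chart_at x], a chart that varies with x with no
    continuity imposed, so a field or a form cannot be differentiated in x as it stands.
    Computations are carried out on maps [g : V -> T] from a normed space ([smooth_into],
    [tangent_map]) read in one fixed chart; curves, inverse charts and the action in a product of
    charts are all instances, and exterior derivatives are compared through pull-backs to V. The
    level and the quotient are known through an immersion and a submersion, which are exploited by
    one-sided inverses of Jacobians: a right inverse, together with the contraction principle, lets
    differentiability descend to the quotient; a left inverse lets it lift to the level, as for the
    orbit curves in J^-1(mu). For higher orders, an inverse chosen at one point is corrected into a
    smooth family by inverting a matrix equal to the identity there. The other obstacle is that
    [lie_exp] is defined by choice: existence of one-parameter subgroups is extracted from the
    regularity of mu, and uniqueness is proved by hand. *)

Section Differentiability.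
Variable R : realType.
Implicit Types U V W : normedModType R.

Lemma near0_shift V (x : V) (P : set V) :
  (\forall y \near x, P y) -> \forall h \near (0 : V), P (h + x).
Proof. by rewrite (near_shift 0 x) subr0. Qed.

(** A first-order expansion determines the differential ([diff_unique]), so exhibiting a candidate
    [df] yields differentiability and its value at once. Every differential built by hand below
    comes from this criterion. *)
Lemma differentiable_eps V W (f : V -> W) (x : V) (df : {linear V -> W}) :
  continuous df ->
  (forall e : R, 0 < e ->
     \forall h \near (0 : V), `|f (h + x) - f x - df h| <= e * `|h|) ->
  differentiable f x /\ forall h, 'd f x h = df h.
Proof.
move=> dfc H.
have E : f \o shift x = cst (f x) + df +o_ (0 : V) id.
  apply/eqaddoP => e e0; have := H _ e0; apply: filterS => h /=.
  by rewrite [(_ - _) h]/= opprD addrA.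
have D := diff_unique dfc E.
by split=> [|h]; [apply/diff_locallyP; rewrite D | rewrite D].
Qed.

Lemma differentiable_near_le V W (f : V -> W) (x : V) :
  differentiable f x -> forall e : R, 0 < e ->
  \forall h \near (0 : V), `|f (h + x) - f x - 'd f x h| <= e * `|h|.
Proof.
move=> /diff_locally /eqaddoP D e e0; have := D _ e0; apply: filterS => h /=.
by rewrite [(_ - _) h]/= opprD addrA.
Qed.

Lemma near_eq_differentiable V W (f g : V -> W) (x : V) :
  (\forall y \near x, f y = g y) -> differentiable f x -> differentiable g x.
Proof.
move=> fg df; suff [] : differentiable g x /\ forall h, 'd g x h = 'd f x h by [].
apply: differentiable_eps => [|e e0]; first exact: diff_continuous.
have fgx := nbhs_singleton fg.
have fg' : \forall h \near (0 : V), f (h + x) = g (h + x) := near0_shift fg.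
near=> h; rewrite -fgx -(near fg' h) //.
by near: h; exact: differentiable_near_le.
Unshelve. all: by end_near. Qed.

Lemma deriveD_dir V W (f : V -> W) (x u v : V) : differentiable f x ->
  'D_(u + v) f x = 'D_u f x + 'D_v f x.
Proof. by move=> df; rewrite !deriveE// linearD. Qed.

Lemma deriveZ_dir V W (f : V -> W) (x v : V) (k : R) : differentiable f x ->
  'D_(k *: v) f x = k *: 'D_v f x.
Proof. by move=> df; rewrite !deriveE// linearZ. Qed.

Lemma deriveN_dir V W (f : V -> W) (x v : V) : differentiable f x ->
  'D_(- v) f x = - 'D_v f x.
Proof. by move=> df; rewrite !deriveE// linearN. Qed.

Lemma derive_sum_dir V W (I : finType) (f : V -> W) (x : V) (k : I -> R)
    (v : I -> V) : differentiable f x ->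
  'D_(\sum_i k i *: v i) f x = \sum_i k i *: 'D_(v i) f x.
Proof.
move=> df; rewrite deriveE// linear_sum; apply: eq_bigr => i _.
by rewrite linearZ deriveE.
Qed.

Lemma derive_comp U V W (f : U -> V) (g : V -> W) (x u : U) :
  differentiable f x -> differentiable g (f x) ->
  'D_u (g \o f) x = 'D_('D_u f x) g (f x).
Proof.
move=> df dg; rewrite deriveE; last exact: differentiable_comp.
by rewrite diff_comp//= [in RHS]deriveE// deriveE.
Qed.

Lemma derive_linear V W (f : {linear V -> W}) (x v : V) : continuous f ->
  'D_v f x = f v.
Proof.
move=> fc; rewrite deriveE ?diff_lin//.
exact: linear_differentiable.
Qed.

(** Scaling is a continuous bilinear map, so the product rule is the differential of a bilinear map
    at a pair, composed with [(a, f)]. *)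
Lemma derive_scale_comp V W (a : V -> R) (f : V -> W) (x : V) :
  differentiable a x -> differentiable f x ->
  differentiable (fun y => a y *: f y) x /\
  forall v, 'D_v (fun y => a y *: f y) x = 'D_v a x *: f x + a x *: 'D_v f x.
Proof.
have bil : bilinear_for (GRing.Scale.Law.clone _ _ *:%R _)
    (GRing.Scale.Law.clone _ _ *:%R _) (fun (k : R) (w : W) => k *: w).
  split=> [u'|u] k y z /=.
  - by rewrite scalerDl scalerA.
  - by rewrite scalerDr !scalerA mulrC.
pose bm := bilinear_isBilinear.Build R R W W _ _
  (fun (k : R) (w : W) => k *: w) bil.
pose b : {bilinear R -> W -> W} := HB.pack (fun (k : R) (w : W) => k *: w) bm.
have bc : continuous (fun p : R * W => b p.1 p.2).
  by move=> p; exact: scale_continuous.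
move=> da df.
have dp : differentiable (fun y => (a y, f y)) x by exact: differentiable_pair.
have db p := differentiable_bilin p bc.
have dc : differentiable ((fun p : R * W => b p.1 p.2) \o (fun y => (a y, f y))) x.
  apply: differentiable_comp => //. 
split=> [//|v].
rewrite -[LHS]/('D_v ((fun p : R * W => b p.1 p.2) \o (fun y => (a y, f y))) x).
rewrite (derive_comp v dp (db _)) (deriveE _ (db _)) diff_bilin//=.
by rewrite (deriveE _ dp) diff_pair//= !deriveE//= addrC.
Qed.

End Differentiability.

(** * Smooth functions on finite-dimensional spaces *)

Section SmoothFunctions.
Variable R : realType.
Implicit Types U V W : normedModType R.

(** A finite spanning family with continuous coordinate functions. It serves to expand the moving
    direction ['D_v f x] of the chain rule along fixed directions, the only ones along which [Ck_on]
    differentiates. *)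
Definition fin_dim V := exists (I : finType) (e : I -> V)
  (l : I -> {linear V -> R^o}),
  (forall i, continuous (l i)) /\ forall w, w = \sum_i l i w *: e i.

Lemma fin_dim_rV n : fin_dim 'rV[R]_n.
Proof.
exists 'I_n, (fun i => delta_mx 0 i).
have lin i : linear (fun w : 'rV[R]_n => w 0 i : R^o).
  by move=> k u v; rewrite !mxE.
pose l i : {linear 'rV[R]_n -> R^o} := HB.pack (fun w : 'rV[R]_n => w 0 i : R^o)
  (GRing.isLinear.Build _ _ _ _ _ (lin i)).
exists l; split=> [i|w]; first exact: coord_continuous.
by rewrite [LHS]row_sum_delta.
Qed.

Lemma fin_dim_prod V W : fin_dim V -> fin_dim W -> fin_dim (V * W)%type.
Proof.
move=> [I [e [l [lc le]]]] [J [f [m [mc me]]]].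
exists (I + J)%type, (fun k => match k with inl i => (e i, 0) | inr j => (0, f j) end).
have lin1 i : linear (fun w : (V * W)%type => l i w.1).
  by move=> k u v /=; rewrite linearP.
have lin2 i : linear (fun w : (V * W)%type => m i w.2).
  by move=> k u v /=; rewrite linearP.
pose l1 i : {linear (V * W)%type -> R^o} := HB.pack (fun w : (V * W)%type => l i w.1)
  (GRing.isLinear.Build _ _ _ _ _ (lin1 i)).
pose l2 i : {linear (V * W)%type -> R^o} := HB.pack (fun w : (V * W)%type => m i w.2)
  (GRing.isLinear.Build _ _ _ _ _ (lin2 i)).
exists (fun k => match k with inl i => l1 i | inr j => l2 j end); split.
  move=> [i|j] p /=; apply: continuous_comp.
  - exact: cvg_fst.
  - exact: lc.
  - exact: cvg_snd.
  - exact: mc.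
move=> w; rewrite big_sumType/=.
have addl (x y : V) : (x + y, 0) = (x, 0) + (y, 0) :> (V * W)%type.
  by congr (_, _); rewrite addr0.
have addr (x y : W) : (0, x + y) = (0, x) + (0, y) :> (V * W)%type.
  by congr (_, _); rewrite addr0.
have -> : \sum_i l i w.1 *: (e i, 0) = (w.1, 0) :> (V * W)%type.
  rewrite [in RHS](le w.1) (big_morph _ addl (erefl : _ = 0)).
  by apply: eq_bigr => i _; congr (_, _); rewrite /= scaler0.
have -> : \sum_i m i w.2 *: (0, f i) = (0, w.2) :> (V * W)%type.
  rewrite [in RHS](me w.2) (big_morph _ addr (erefl : _ = 0)).
  by apply: eq_bigr => i _; congr (_, _); rewrite /= scaler0.
by case: w => w1 w2 /=; congr (_, _); rewrite ?addr0 ?add0r.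
Qed.

Lemma Ck_on_sub V W k (U U' : set V) (f : V -> W) :
  U' `<=` U -> Ck_on k U f -> Ck_on k U' f.
Proof.
elim: k f => [|k IH] f s /=; first by move=> h x /s/h.
by move=> [h1 h2]; split=> [x /s/h1//|v]; apply: IH.
Qed.

Lemma Ck_on_eq V W k (U : set V) (f g : V -> W) :
  open U -> (forall x, U x -> f x = g x) -> Ck_on k U f -> Ck_on k U g.
Proof.
move=> oU; elim: k f g => [|k IH] f g fg /=.
  move=> h x Ux; have := h _ Ux; rewrite /prop_for /continuous_at (fg _ Ux).
  apply: cvg_trans; apply: near_eq_cvg.
  by near=> y; apply: fg; near: y; exact: open_nbhs_nbhs.
have nfg x : U x -> \forall y \near x, f y = g y.
  by move=> Ux; near=> y; apply: fg; near: y; exact: open_nbhs_nbhs.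
move=> [h1 h2]; split=> [x Ux|v].
  by apply: near_eq_differentiable (h1 _ Ux); exact: nfg.
apply: IH (h2 v) => x Ux.
by apply: near_eq_derive; exact: nfg.
Unshelve. all: by end_near. Qed.

Lemma Ck_onW V W k (U : set V) (f : V -> W) : Ck_on k.+1 U f -> Ck_on k U f.
Proof.
elim: k f => [|k IH] f /= [h1 h2].
  by move=> x Ux; apply: differentiable_continuous; exact: h1.
by split=> // v; apply: IH; exact: h2.
Qed.

Lemma Ck_on_local V W k (U : set V) (f : V -> W) :
  (forall x, U x -> exists2 U' : set V, U' x & Ck_on k U' f) -> Ck_on k U f.
Proof.
elim: k f => [|k IH] f /= h.
  by move=> x /h[U' U'x]; apply.
split=> [x /h[U' U'x [+ _]]|v]; first exact.
by apply: IH => x /h[U' U'x [_ h']]; exists U'.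
Qed.

Lemma Ck_on_linear_comp V W W' k (U : set V) (f : V -> W) (l : {linear W -> W'}) :
  open U -> continuous l -> Ck_on k U f -> Ck_on k U (l \o f).
Proof.
move=> oU lc; elim: k f => [|k IH] f /=.
  by move=> h x Ux; apply: continuous_comp; [exact: h|exact: lc].
move=> [h1 h2]; split=> [x Ux|v].
  by apply: differentiable_comp; [exact: h1 | exact: linear_differentiable].
apply: Ck_on_eq oU _ (IH _ (h2 v)) => x Ux /=.
rewrite derive_comp ?derive_linear//; first exact: h1.
exact: linear_differentiable.
Qed.

Lemma Ck_on_cst V W k (U : set V) (c : W) : Ck_on k U (cst c : V -> W).
Proof.
elim: k c => [|k IH] c /=; first by move=> x _; exact: cvg_cst.
split=> [x _|v]; first exact: differentiable_cst.
suff -> : (fun x : V => 'D_v (cst c : V -> W) x) = cst 0 by exact: IH.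
by apply/funext => x; rewrite derive_cst.
Qed.

Lemma Ck_on_linear V W k (U : set V) (l : {linear V -> W}) :
  continuous l -> Ck_on k U l.
Proof.
move=> lc; case: k => [|k] /=; first by move=> x _; exact: lc.
split=> [x _|v]; first exact: linear_differentiable.
suff -> : (fun x : V => 'D_v l x) = cst (l v) by exact: Ck_on_cst.
by apply/funext => x; rewrite derive_linear.
Qed.

Lemma Ck_onD V W k (U : set V) (f g : V -> W) :
  open U -> Ck_on k U f -> Ck_on k U g -> Ck_on k U (fun x => f x + g x).
Proof.
move=> oU; elim: k f g => [|k IH] f g /=.
  by move=> hf hg x Ux; apply: cvgD; [exact: hf | exact: hg].
move=> [f1 f2] [g1 g2]; split=> [x Ux|v].
  by apply: differentiableD; [exact: f1 | exact: g1].
apply: Ck_on_eq oU _ (IH _ _ (f2 v) (g2 v)) => x Ux /=.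
by rewrite -deriveD//; apply: diff_derivable; [exact: f1|exact: g1].
Qed.

Lemma Ck_on_sum V W (I : finType) k (U : set V) (f : I -> V -> W) :
  open U -> (forall i, Ck_on k U (f i)) -> Ck_on k U (fun x => \sum_i f i x).
Proof.
move=> oU fs; elim: (index_enum I) => [|i s IH].
  by apply: Ck_on_eq oU _ (@Ck_on_cst _ _ _ _ 0) => x Ux; rewrite big_nil.
apply: Ck_on_eq oU _ (Ck_onD oU (fs i) IH) => x Ux.
by rewrite big_cons.
Qed.

Lemma Ck_onZ V W k (U : set V) (a : V -> R) (f : V -> W) :
  open U -> Ck_on k U a -> Ck_on k U f -> Ck_on k U (fun x => a x *: f x).
Proof.
move=> oU; elim: k a f => [|k IH] a f /=.
  by move=> ha hf x Ux; apply: cvgZ; [exact: ha | exact: hf].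
move=> [a1 a2] [f1 f2].
have h x (Ux : U x) := derive_scale_comp (a1 x Ux) (f1 x Ux).
split=> [x /h[]//|v].
have a0 : Ck_on k U a by apply: Ck_onW; split.
have f0 : Ck_on k U f by apply: Ck_onW; split.
apply: Ck_on_eq oU _ (Ck_onD oU (IH _ _ (a2 v) f0) (IH _ _ a0 (f2 v))) => x Ux.
by rewrite (h x Ux).2.
Qed.

Lemma Ck_on_inv V k (U : set V) (a : V -> R) :
  open U -> (forall x, U x -> a x != 0) -> Ck_on k U a ->
  Ck_on k U (fun x => (a x)^-1).
Proof.
move=> oU a0; elim: k => [|k IH] /=.
  by move=> ha x Ux; apply: cvgV; [exact: a0 | exact: ha].
move=> [a1 a2]; split=> [x Ux|v].
  by apply: differentiableV; [exact: a1 | exact: a0].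
have ak : Ck_on k U (fun x => (a x)^-1) by apply: IH; apply: Ck_onW; split.
(* The derivative of 1/a is -(1/a)^2 times that of a; nesting the products lets the induction
   hypothesis on 1/a be used for each factor. *)
have a2k := Ck_onZ oU ak (Ck_onZ oU ak (Ck_onZ oU (Ck_on_cst _ U (-1 : R)) (a2 v))).
apply: Ck_on_eq oU _ a2k => x Ux /=.
rewrite (@deriveV _ _ a x v (a0 _ Ux)); last by apply: diff_derivable; exact: a1.
by rewrite /GRing.scale/= -exprVn expr2 mulN1r !mulrN !mulNr mulrA.
Qed.

(** In ['D_('D_v f x) g (f x)] the direction depends on x. Expanding it over the spanning family
    gives a sum of products, where the induction hypothesis applies to each ['D_(e i) g] composed
    with [f]. *)
Lemma Ck_on_comp V V' W k (U : set V) (U' : set V') (f : V -> V') (g : V' -> W) :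
  fin_dim V' -> open U -> open U' -> (forall x, U x -> U' (f x)) ->
  Ck_on k U f -> Ck_on k U' g -> Ck_on k U (g \o f).
Proof.
move=> [I [e [l [lc le]]]] oU oU'; elim: k f g => [|k IH] f g fU /=.
  move=> hf hg x Ux; apply: continuous_comp; first exact: hf.
  by apply: hg; exact: fU.
move=> [f1 f2] [g1 g2]; split=> [x Ux|v].
  apply: differentiable_comp; first exact: f1.
  by apply: g1; exact: fU.
have f0 : Ck_on k U f by apply: Ck_onW; split.
apply: (@Ck_on_eq _ _ _ _
  (fun x => \sum_i l i ('D_v f x) *: 'D_(e i) g (f x))) => //.
  move=> x Ux; have gf : differentiable g (f x) by apply: g1; exact: fU.
  rewrite -[RHS]/('D_v (g \o f) x) derive_comp//; last exact: f1.
  by rewrite [X in 'D_X g _]le derive_sum_dir.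
apply: Ck_on_sum => // i; apply: Ck_onZ => //.
  exact: Ck_on_linear_comp.
by apply: (IH f ('D_(e i) g)) => //; exact: g2.
Qed.

End SmoothFunctions.

(** * Smoothness at a point and its closure properties *)

Section SmoothAt.
Variable R : realType.
Implicit Types U V W : normedModType R.

(** One neighbourhood serves all orders at once, which makes the condition open in [x] and spares
    the bookkeeping of domains. *)
Definition smooth_at V W (f : V -> W) (x : V) :=
  exists2 U : set V, open_nbhs x U & smooth_on U f.

Lemma smooth_on_at V W (U : set V) (f : V -> W) :
  open U -> smooth_on U f -> forall x, U x -> smooth_at f x.
Proof. by move=> oU sf x Ux; exists U. Qed.

Lemma smooth_at_on V W (U : set V) (f : V -> W) :
  (forall x, U x -> smooth_at f x) -> smooth_on U f.
Proof.
move=> h k; apply: Ck_on_local => x /h[U' [oU' U'x] sf].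
by exists U' => //; exact: sf.
Qed.

Lemma near_smooth_at V W (f : V -> W) x :
  smooth_at f x -> \forall y \near x, smooth_at f y.
Proof.
move=> [U [oU Ux] sf]; apply: filterS (open_nbhs_nbhs (conj oU Ux)) => y Uy.
by exists U.
Qed.

Lemma near_open (T : topologicalType) (x : T) (P : set T) :
  (\forall y \near x, P y) -> exists2 U, open_nbhs x U & U `<=` P.
Proof. by rewrite /prop_near1 nbhsE. Qed.

Lemma smooth_at_eq V W (f g : V -> W) x :
  (\forall y \near x, f y = g y) -> smooth_at f x -> smooth_at g x.
Proof.
move=> /near_open -[U' [oU' U'x] fg] [U [oU Ux] sf].
exists (U `&` U'); first by split; [exact: openI | split].
move=> k; apply: (@Ck_on_eq _ _ _ _ _ f); first exact: openI.
  by move=> y [_ /fg].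
by apply: Ck_on_sub (sf k) => y [].
Qed.

Lemma smooth_at_differentiable V W (f : V -> W) x :
  smooth_at f x -> differentiable f x.
Proof. by move=> [U [oU Ux] sf]; exact: (sf 1).1. Qed.

Lemma smooth_at_continuous V W (f : V -> W) x :
  smooth_at f x -> {for x, continuous f}.
Proof.
by move=> /smooth_at_differentiable; exact: differentiable_continuous.
Qed.

Lemma smooth_at_derive V W (f : V -> W) x v :
  smooth_at f x -> smooth_at ('D_v f) x.
Proof. by move=> [U oU sf]; exists U => // k; exact: (sf k.+1).2. Qed.

Lemma smooth_at_cst V W (c : W) (x : V) : smooth_at (fun _ => c) x.
Proof.
by exists setT; [split=> //; exact: openT | move=> k; exact: Ck_on_cst].
Qed.

Lemma smooth_at_linear V W (l : {linear V -> W}) x :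
  continuous l -> smooth_at l x.
Proof.
move=> lc; exists setT; first by split=> //; exact: openT.
by move=> k; exact: Ck_on_linear.
Qed.

Lemma smooth_at_id V (x : V) : smooth_at id x.
Proof.
have h : continuous (idfun : {linear V -> V}) by move=> y; exact: cvg_id.
exact: (@smooth_at_linear _ _ (idfun : {linear V -> V}) x h).
Qed.

Lemma smooth_atD V W (f g : V -> W) x :
  smooth_at f x -> smooth_at g x -> smooth_at (fun y => f y + g y) x.
Proof.
move=> [U [oU Ux] sf] [U' [oU' U'x] sg].
exists (U `&` U'); first by split; [exact: openI | split].
move=> k; apply: Ck_onD; first exact: openI.
  by apply: Ck_on_sub (sf k) => y [].
by apply: Ck_on_sub (sg k) => y [].
Qed.

Lemma smooth_atZ V W (a : V -> R) (f : V -> W) x :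
  smooth_at a x -> smooth_at f x -> smooth_at (fun y => a y *: f y) x.
Proof.
move=> [U [oU Ux] sf] [U' [oU' U'x] sg].
exists (U `&` U'); first by split; [exact: openI | split].
move=> k; apply: Ck_onZ; first exact: openI.
  by apply: Ck_on_sub (sf k) => y [].
by apply: Ck_on_sub (sg k) => y [].
Qed.

Lemma smooth_atM V (a b : V -> R) x :
  smooth_at a x -> smooth_at b x -> smooth_at (fun y => a y * b y) x.
Proof. exact: smooth_atZ. Qed.

Lemma smooth_atN V W (f : V -> W) x :
  smooth_at f x -> smooth_at (fun y => - f y) x.
Proof.
move=> sf; apply: smooth_at_eq (smooth_atZ (@smooth_at_cst V R (-1) x) sf).
by apply: nearW => y; rewrite scaleN1r.
Qed.

Lemma smooth_at_sum V W (I : Type) (s : seq I) (P : pred I) (f : I -> V -> W) x :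
  (forall i, smooth_at (f i) x) -> smooth_at (fun y => \sum_(i <- s | P i) f i y) x.
Proof.
move=> sf; elim: s => [|i s IH].
  apply: smooth_at_eq (@smooth_at_cst V W 0 x).
  by apply: nearW => y; rewrite big_nil.
case Pi : (P i).
  apply: smooth_at_eq (smooth_atD (sf i) IH).
  by apply: nearW => y; rewrite big_cons Pi.
by apply: smooth_at_eq IH; apply: nearW => y; rewrite big_cons Pi.
Qed.

Lemma smooth_at_prod V (I : Type) (s : seq I) (f : I -> V -> R) x :
  (forall i, smooth_at (f i) x) -> smooth_at (fun y => \prod_(i <- s) f i y) x.
Proof.
move=> sf; elim: s => [|i s IH].
  apply: smooth_at_eq (@smooth_at_cst V R 1 x).
  by apply: nearW => y; rewrite big_nil.
apply: smooth_at_eq (smooth_atM (sf i) IH).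
by apply: nearW => y; rewrite big_cons.
Qed.

Lemma smooth_at_inv V (a : V -> R) x :
  a x != 0 -> smooth_at a x -> smooth_at (fun y => (a y)^-1) x.
Proof.
move=> ax0 sa; have := smooth_at_continuous sa.
have [U [oU Ux] sf] := sa => ca.
have : \forall y \near x, a y != 0.
  exact: (ca [set z | z != 0] (open_nbhs_nbhs (conj (@open_neq R 0) ax0))).
move=> /near_open[U' [oU' U'x] h].
exists (U `&` U'); first by split; [exact: openI | split].
move=> k; apply: Ck_on_inv; first exact: openI.
  by move=> y [_ /h].
by apply: Ck_on_sub (sf k) => y [].
Qed.

Lemma smooth_at_comp V V' W (f : V -> V') (g : V' -> W) x : fin_dim V' ->
  smooth_at f x -> smooth_at g (f x) -> smooth_at (g \o f) x.
Proof.
move=> fd sf; have cf := smooth_at_continuous sf.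
case: sf => [U [oU Ux] sf] [U' [oU' U'x] sg].
have : \forall y \near x, U' (f y).
  exact: (cf U' (open_nbhs_nbhs (conj oU' U'x))).
move=> /near_open[U'' [oU'' U''x] h].
exists (U `&` U''); first by split; [exact: openI | split].
move=> k; apply: (Ck_on_comp fd (openI oU oU'') oU') (sg k).
  by move=> y [_ /h].
by apply: Ck_on_sub (sf k) => y [].
Qed.

Lemma smooth_at_linear_comp V W W' (l : {linear W -> W'}) (f : V -> W) x :
  continuous l -> smooth_at f x -> smooth_at (l \o f) x.
Proof.
move=> lc [U [oU Ux] sf]; exists U => // k.
exact: Ck_on_linear_comp (sf k).
Qed.

Lemma smooth_at_coord V n (f : V -> 'rV[R]_n) i x :
  smooth_at f x -> smooth_at (fun y => f y 0 i) x.
Proof.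
have lin : linear (fun w : 'rV[R]_n => w 0 i : R^o).
  by move=> k u v; rewrite !mxE.
pose l : {linear 'rV[R]_n -> R^o} := HB.pack (fun w : 'rV[R]_n => w 0 i : R^o)
  (GRing.isLinear.Build _ _ _ _ _ lin).
by apply: (@smooth_at_linear_comp _ _ _ l); exact: coord_continuous.
Qed.

Lemma smooth_at_rV V n (f : V -> 'rV[R]_n) x :
  (forall i, smooth_at (fun y => f y 0 i) x) -> smooth_at f x.
Proof.
move=> sf.
have h : smooth_at (fun y => \sum_i f y 0 i *: (delta_mx 0 i : 'rV[R]_n)) x.
  by apply: smooth_at_sum => i; apply: smooth_atZ => //; exact: smooth_at_cst.
by apply: smooth_at_eq h; apply: nearW => y; rewrite -row_sum_delta.
Qed.

Lemma smooth_at_pair V W W' (f : V -> W) (g : V -> W') x :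
  smooth_at f x -> smooth_at g x -> smooth_at (fun y => (f y, g y)) x.
Proof.
have lin1 : linear (fun w : W => (w, 0) : (W * W')%type).
  by move=> k u v; congr (_, _); rewrite /= scaler0 addr0.
have lin2 : linear (fun w : W' => (0, w) : (W * W')%type).
  by move=> k u v; congr (_, _); rewrite /= scaler0 addr0.
pose l1 : {linear W -> (W * W')%type} := HB.pack (fun w : W => (w, 0) : (W * W')%type)
  (GRing.isLinear.Build _ _ _ _ _ lin1).
pose l2 : {linear W' -> (W * W')%type} := HB.pack (fun w : W' => (0, w) : (W * W')%type)
  (GRing.isLinear.Build _ _ _ _ _ lin2).
have c1 : continuous l1 by move=> w; apply: cvg_pair => //=; exact: cvg_cst.
have c2 : continuous l2 by move=> w; apply: cvg_pair => //=; exact: cvg_cst.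
move=> sf sg.
have := smooth_atD (smooth_at_linear_comp c1 sf) (smooth_at_linear_comp c2 sg).
apply: smooth_at_eq; apply: nearW => y /=.
by congr (_, _); rewrite /= ?addr0 ?add0r.
Qed.

Lemma smooth_at_det V n (A : V -> 'M[R]_n) x :
  (forall i j, smooth_at (fun y => A y i j) x) -> smooth_at (fun y => \det (A y)) x.
Proof.
move=> sA; rewrite /determinant; apply: smooth_at_sum => s.
apply: smooth_atM; first exact: smooth_at_cst.
by apply: smooth_at_prod.
Qed.

(** Cramer's rule: where the determinant does not vanish, the entries of the inverse are cofactors
    divided by it, hence smooth in the entries of [A]. *)
Lemma smooth_at_invmx V n (A : V -> 'M[R]_n) x : A x \in unitmx ->
  (forall i j, smooth_at (fun y => A y i j) x) ->
  (\forall y \near x, A y \in unitmx) /\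
  forall i j, smooth_at (fun y => invmx (A y) i j) x.
Proof.
move=> Ax sA; have sd := smooth_at_det sA.
have dx0 : \det (A x) != 0 by rewrite -unitfE -unitmxE.
have nu : \forall y \near x, A y \in unitmx.
  have := smooth_at_continuous sd => ca.
  have : \forall y \near x, \det (A y) != 0.
    exact: (ca [set z | z != 0] (open_nbhs_nbhs (conj (@open_neq R 0) dx0))).
  by apply: filterS => y; rewrite unitmxE unitfE.
split=> // i j.
apply: (@smooth_at_eq _ _ (fun y => (\det (A y))^-1 * cofactor (A y) j i)).
  by apply: filterS nu => y Ay; rewrite /invmx Ay !mxE.
apply: smooth_atM; first exact: smooth_at_inv.
rewrite /cofactor; apply: smooth_atM; first exact: smooth_at_cst.
apply: smooth_at_det => k l.
by apply: smooth_at_eq (sA (lift j k) (lift i l)); apply: nearW => y; rewrite !mxE.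
Qed.

Lemma smooth_at_mulmx V m n p (A : V -> 'M[R]_(m, n)) (B : V -> 'M[R]_(n, p)) x :
  (forall i j, smooth_at (fun y => A y i j) x) ->
  (forall i j, smooth_at (fun y => B y i j) x) ->
  forall i j, smooth_at (fun y => (A y *m B y) i j) x.
Proof.
move=> sA sB i j.
have h : smooth_at (fun y => \sum_k A y i k * B y k j) x.
  by apply: smooth_at_sum => k; exact: smooth_atM.
by apply: smooth_at_eq h; apply: nearW => y; rewrite !mxE.
Qed.

End SmoothAt.

(** * Symmetry of second derivatives, local inversion *)

Section MeanValue.
Variable R : realType.
Implicit Types U V W : normedModType R.

Lemma derive_line V (x v : V) (t : R) :
  differentiable (fun t : R => x + t *: v) t /\
  'D_1 (fun t : R => x + t *: v) t = v.
Proof.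
have [d D] := @derive_scale_comp R R V id (cst v) t (smooth_at_differentiable (smooth_at_id t)) (differentiable_cst _ _).
have d1 : differentiable (fun t : R => x + t *: v) t.
  by apply: (@differentiableD _ _ _ (cst x)) => //; exact: differentiable_cst.
split=> //; have -> : (fun t : R => x + t *: v) = cst x + (fun t => t *: v) by [].
rewrite deriveD; [|exact: derivable_cst|exact: diff_derivable].
by rewrite D !derive_cst derive_id scaler0 addr0 add0r scale1r.
Qed.

Lemma MVT_line V (f : V -> R) (x v : V) (h : R) : 0 <= h ->
  (forall t : R, 0 <= t <= h -> differentiable f (x + t *: v)) ->
  exists2 c, 0 <= c <= h & f (x + h *: v) - f x = h * 'D_v f (x + c *: v).
Proof.
move=> h0 df.
have dg t : 0 <= t <= h ->
    is_derive t 1 (fun t : R => f (x + t *: v)) ('D_v f (x + t *: v)).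
  move=> /df dft; have [d D] := derive_line x v t.
  apply: DeriveDef; first by apply: diff_derivable; exact: differentiable_comp.
  by rewrite -[LHS]/('D_1 (f \o (fun t : R => x + t *: v)) t) derive_comp// D.
have [t|t|c cI E] := @MVT_segment R (fun t => f (x + t *: v)) (fun t => 'D_v f (x + t *: v)) 0 h h0.
- by rewrite in_itv/= => /andP[t0 t1]; apply: dg; rewrite !ltW.
- apply: continuous_in_subspaceT t => t; rewrite inE/= in_itv/= => /dg [dt _].
  by apply: differentiable_continuous; exact/derivable1_diffP.
- exists c; first by move: cI; rewrite in_itv.
  by move: E; rewrite scale0r addr0 subr0 mulrC.
Qed.

(* The same second difference is a multiple of 'D_v ('D_u f) and, exchanging u and
   v, of 'D_u ('D_v f), at two points close to x; hence Schwarz's theorem. *)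
Lemma second_difference V (f : V -> R) (x u v : V) (h : R) : 0 <= h ->
  (forall s t : R, 0 <= s <= h -> 0 <= t <= h -> smooth_at f (x + s *: u + t *: v)) ->
  exists c c' : R, [/\ 0 <= c <= h, 0 <= c' <= h &
    f (x + h *: u + h *: v) - f (x + h *: u) - (f (x + h *: v) - f x) =
    h * (h * 'D_v ('D_u f) (x + c *: u + c' *: v))].
Proof.
move=> h0 sf; have hh : 0 <= h <= h by rewrite h0 lexx.
have h00 : (0 : R) <= 0 <= h by rewrite h0 lexx.
pose g z := f (z + h *: v) - f z.
have d1 s : 0 <= s <= h -> differentiable f (x + s *: u).
  by move=> sh; have /smooth_at_differentiable := sf s 0 sh h00; rewrite scale0r addr0.
have d2 s : 0 <= s <= h ->
    differentiable (fun z => f (z + h *: v)) (x + s *: u) /\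
    'D_u (fun z => f (z + h *: v)) (x + s *: u) = 'D_u f (x + s *: u + h *: v).
  move=> sh; have df := smooth_at_differentiable (sf s h sh hh).
  have dt : differentiable (fun z : V => z + h *: v) (x + s *: u).
    by apply: (@differentiableD _ _ _ id (cst _)) => //; exact: differentiable_cst.
  have Dt : 'D_u (fun z : V => z + h *: v) (x + s *: u) = u.
    rewrite -[LHS]/('D_u (id + cst (h *: v)) _) deriveD//.
    by rewrite derive_id derive_cst addr0.
  split; first exact: (differentiable_comp dt df).
  by rewrite -[LHS]/('D_u (f \o (fun z : V => z + h *: v)) (x + s *: u)) derive_comp// Dt.
have [t th|c ch E] := @MVT_line V g x u h h0.
  by apply: differentiableB; [exact: (d2 t th).1 | exact: d1].
have [t th|c' ch' E'] := @MVT_line V ('D_u f) (x + c *: u) v h h0.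
  by apply/smooth_at_differentiable/smooth_at_derive/sf.
exists c, c'; split=> //; rewrite -E' -(d2 c ch).2.
have -> : f (x + h *: u + h *: v) - f (x + h *: u) - (f (x + h *: v) - f x) = g (x + h *: u) - g x by [].
rewrite E; congr (_ * _).
rewrite -[g]/((fun z => f (z + h *: v)) - f) deriveB//.
  by apply: diff_derivable; exact: (d2 c ch).1.
by apply: diff_derivable; exact: d1.
Qed.

Lemma ler_dist_half (e p q r : R) :
  `|q - p| <= e / 2 -> `|r - p| <= e / 2 -> `|q - r| <= e.
Proof.
move=> h1 h2; rewrite (splitr e) (le_trans (ler_distD p _ _))// lerD//.
by rewrite distrC.
Qed.

Lemma deriveC_real V (f : V -> R) (x u v : V) : smooth_at f x ->
  'D_u ('D_v f) x = 'D_v ('D_u f) x.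
Proof.
move=> sf; apply/eqP; rewrite -subr_eq0 -normr_le0; apply/ler_addgt0Pl => e e0.
rewrite addr0.
have c1 := smooth_at_continuous (smooth_at_derive u (smooth_at_derive v sf)).
have c2 := smooth_at_continuous (smooth_at_derive v (smooth_at_derive u sf)).
have e20 : 0 < e / 2 by rewrite divr_gt0.
have n1 : \forall y \near x, `|'D_u ('D_v f) x - 'D_u ('D_v f) y| <= e / 2.
  by move/cvgrPdist_le : c1 => /(_ _ e20).
have n2 : \forall y \near x, `|'D_v ('D_u f) x - 'D_v ('D_u f) y| <= e / 2.
  by move/cvgrPdist_le : c2 => /(_ _ e20).
have [d /= d0 H] := (nbhs_ballP _ _).1 (filterI (near_smooth_at sf) (filterI n1 n2)).
(* With this side, the whole parallelogram spanned at [x] by [h *: u] and [h *: v] lies in the ball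
   of radius [d]; the summand 1 keeps the divisor positive when [u] and [v] vanish. *)
pose h := d / 2 / (1 + `|u| + `|v|).
have p0 : 0 < 1 + `|u| + `|v| by rewrite -addrA ltr_wpDr ?addr_ge0.
have h0 : 0 < h by rewrite !divr_gt0.
have near1 s t : 0 <= s <= h -> 0 <= t <= h -> ball x d (x + s *: u + t *: v).
  move=> /andP[s0 sh] /andP[t0 th].
  rewrite -ball_normE/= -addrA opprD addNKr.
  rewrite normrN (le_lt_trans (ler_normD _ _))// !normrZ !ger0_norm//.
  apply: (@le_lt_trans _ _ (h * (1 + `|u| + `|v|))).
    rewrite -addrA mulrDr mulr1 mulrDr -[leLHS]add0r; apply: lerD; first exact: ltW.
    by apply: lerD; exact: ler_wpM2r.
  by rewrite divfK ?gt_eqF// ltr_pdivrMr// mulr_natr mulr2n ltrDl.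
have [s t sh th|c [c' [ch ch' E]]] := @second_difference V f x u v h (ltW h0).
  by have [] := H _ (near1 _ _ sh th).
have [s t sh th|k [k' [kh kh' E']]] := @second_difference V f x v u h (ltW h0).
  by rewrite addrAC; have [] := H _ (near1 _ _ th sh).
have hn0 : h != 0 by rewrite gt_eqF.
have EE : 'D_v ('D_u f) (x + c *: u + c' *: v) =
         'D_u ('D_v f) (x + k' *: u + k *: v).
  have P1 : x + h *: v + h *: u = x + h *: u + h *: v by rewrite addrAC.
  have P2 : x + k *: v + k' *: u = x + k' *: u + k *: v by rewrite addrAC.
  rewrite P1 P2 in E'.
  apply: (mulfI hn0); apply: (mulfI hn0); apply: (etrans (esym E)).
  apply: (etrans _ E').
  move: (f _) (f _) (f _) (f _) => p1 p2 p3 p4; lra.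
have [_ [_ b1]] := H _ (near1 _ _ ch ch').
have [_ [b2 _]] := H _ (near1 _ _ kh' kh).
rewrite EE in b1; exact: ler_dist_half b2 b1.
Qed.

Lemma deriveC V n (f : V -> 'rV[R]_n) (x u v : V) : smooth_at f x ->
  'D_u ('D_v f) x = 'D_v ('D_u f) x.
Proof.
have D1 w y (g : V -> 'rV[R]_n) i : smooth_at g y -> ('D_w g y) 0 i = 'D_w (fun z => g z 0 i) y.
  move=> sg; rewrite derive_mx ?mxE//.
  by apply: diff_derivable; exact: smooth_at_differentiable.
have D2 w w' i : smooth_at f x ->
   ('D_w' ('D_w f) x) 0 i = 'D_w' ('D_w (fun z => f z 0 i)) x.
  move=> sf; rewrite D1; last exact: smooth_at_derive.
  apply: near_eq_derive; apply: filterS (near_smooth_at sf) => y; exact: D1.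
move=> sf; apply/rowP => i; apply: (etrans (D2 v u i sf)).
apply: (etrans _ (esym (D2 u v i sf))).

by apply: deriveC_real; exact: smooth_at_coord.
Qed.

End MeanValue.

(** * Mean value estimates in several variables *)

Section LocalInversion.
Variable R : realType.
Implicit Types U V W : normedModType R.

Lemma linear_rV_continuous n W (l : {linear 'rV[R]_n -> W}) : continuous l.
Proof.
have -> : (l : _ -> _) = fun w : 'rV[R]_n => \sum_i w 0 i *: l (delta_mx 0 i).
  apply/funext => w; rewrite [in LHS](row_sum_delta w) linear_sum.
  by apply: eq_bigr => i _; rewrite linearZ.
move=> w; apply: smooth_at_continuous; apply: smooth_at_sum => i.
by apply: smooth_atZ; [apply/smooth_at_coord/smooth_at_id|exact: smooth_at_cst].
Qed.

Lemma coord_norm_le m n (M : 'M[R]_(m, n)) i j : `|M i j| <= `|M|.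
Proof.
rewrite [leRHS]/Num.norm/= mx_normrE.
exact: (@le_bigmax _ _ _ 0 (fun ij => `|M ij.1 ij.2|) (i, j)).
Qed.

Lemma near0_ball V (P : set V) : (\forall h \near (0 : V), P h) ->
  exists2 r : R, 0 < r & forall h, `|h| < r -> P h.
Proof.
move=> /nbhs_ballP[r /= r0 H]; exists r => // h hr; apply: H.
by rewrite -ball_normE/= sub0r normrN.
Qed.

Lemma linear_bound V W (l : {linear V -> W}) : continuous l ->
  exists2 C : R, 0 < C & forall h, `|l h| <= C * `|h|.
Proof. by move=> /linear_lipschitz. Qed.

Lemma smooth_at_jacobian n m (f : 'rV[R]_n -> 'rV[R]_m) x : smooth_at f x ->
  forall i j, smooth_at (fun y => jacobian f y i j) x.
Proof.
move=> sf i j; have h := smooth_at_coord j (smooth_at_derive (delta_mx 0 i) sf).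
apply: smooth_at_eq h; apply: filterS (near_smooth_at sf) => y sy.
by rewrite deriveEjacobian -?rowE ?mxE//; exact: smooth_at_differentiable.
Qed.

Lemma derive_coord V n (f : V -> 'rV[R]_n) (x v : V) i : differentiable f x ->
  'D_v (fun y => f y 0 i) x = 'D_v f x 0 i.
Proof. by move=> df; rewrite derive_mx ?mxE//; exact: diff_derivable. Qed.

Lemma derive_eq0_const n (e : R -> 'rV[R]_n) (t0 d : R) :
  (forall t, `|t - t0| < d -> differentiable e t /\ 'D_1 e t = 0) ->
  forall t, `|t - t0| < d -> e t = e t0.
Proof.
move=> H.
have key a b : a <= b -> (forall t, a <= t <= b -> `|t - t0| < d) -> e b = e a.
  move=> ab h; apply/rowP => i; apply/eqP; rewrite -subr_eq0; apply/eqP.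
  have dcoord t : a <= t <= b -> differentiable (fun y => e y 0 i) t.
    move=> /h/H[de _].
    exact: (@differentiable_comp _ _ _ _ e (fun w : 'rV[R]_n => w 0 i) t de (differentiable_coord _ _ _)).
  have ba0 : 0 <= b - a by rewrite subr_ge0.
  have sh t : 0 <= t <= b - a -> a <= a + t *: (1 : R) <= b.
    by rewrite /GRing.scale/= mulr1 lerDl lerBrDl.
  have [t /sh th|c /sh ch E] := @MVT_line R R (fun y => e y 0 i) a 1 (b - a) ba0.
    exact: dcoord.
  have e1 : a + (b - a) *: (1 : R) = b by rewrite /GRing.scale/= mulr1 addrC subrK.
  rewrite e1 in E; rewrite E.
  have [de de0] := H _ (h _ ch).
  by rewrite derive_coord// de0 mxE mulr0.
move=> t td; have [tt|tt] := leP t0 t.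
  apply: key => // s /andP[s1 s2]; rewrite (le_lt_trans _ td)//.
  by rewrite !ger0_norm ?subr_ge0// lerD2r.
apply/esym; apply: key; first exact: ltW.
move=> s /andP[s1 s2]; rewrite (le_lt_trans _ td)//.
by rewrite !ler0_norm ?subr_le0 ?(ltW tt)// lerN2 lerD2r.
Qed.

(** The mean value theorem is applied to each coordinate of [G] along the segment from [b] to [a],
    which stays in the ball by convexity. The factor [n] counts the partial derivatives, each entry
    of [a - b] being bounded by the sup norm. *)
Lemma lipschitz_partials n m (G : 'rV[R]_n -> 'rV[R]_m) (r eps : R) :
  (forall w, `|w| < r -> differentiable G w /\
     forall i, `|'D_(delta_mx 0 i) G w| <= eps) ->
  forall a b, `|a| < r -> `|b| < r -> `|G a - G b| <= n%:R * eps * `|a - b|.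
Proof.
move=> H a b ar br.
have seg (c : R) : 0 <= c <= 1 -> `|b + c *: (a - b)| < r.
  move=> /andP[c0 c1].
  have -> : b + c *: (a - b) = c *: a + (1 - c) *: b.
    by rewrite scalerBr scalerBl scale1r addrCA addrA.
  rewrite (le_lt_trans (ler_normD _ _))// !normrZ !ger0_norm ?subr_ge0//.
  have : c * `|a| <= c * Num.max `|a| `|b| by rewrite ler_wpM2l// le_max lexx.
  have : (1 - c) * `|b| <= (1 - c) * Num.max `|a| `|b|.
    by rewrite ler_wpM2l ?subr_ge0// le_max lexx orbT.
  move=> h1 h2; apply: le_lt_trans (lerD h2 h1) _.
  by rewrite -mulrDl addrC subrK mul1r gt_max ar br.
(* [H] bounds a norm by [eps], so [eps] is nonnegative as soon as there is a coordinate direction;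
   for [n = 0] the product vanishes. *)
have eps0 : 0 <= n%:R * eps.
  case: n G H a b ar br seg => [|n] G H a b ar br seg; first by rewrite mul0r.
  by rewrite mulr_ge0//; have [_ /(_ ord0)] := H _ ar; apply: le_trans.
rewrite [leLHS]/Num.norm/= mx_normrE; apply: bigmax_le => [|[i j] _].
  by rewrite mulr_ge0.
rewrite ord1 /= !mxE.
have dG (c : R) : 0 <= c <= 1 -> differentiable (fun y => G y 0 j) (b + c *: (a - b)).
  move=> /seg /H[dG _].
  exact: (@differentiable_comp _ _ _ _ G (fun w : 'rV[R]_m => w 0 j) _ dG (differentiable_coord _ _ _)).
have [t|c c01] := @MVT_line R _ (fun y => G y 0 j) b (a - b) 1 ler01; first exact: dG.
have -> : b + 1 *: (a - b) = a by rewrite scale1r addrC subrK.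
rewrite mul1r => ->.
have [dGc Gc] := H _ (seg _ c01).
rewrite derive_coord// [X in 'D_X _ _](row_sum_delta (a - b)) derive_sum_dir//.
rewrite summxE (le_trans (ler_norm_sum _ _ _))//.
have -> : n%:R * eps * `|a - b| = \sum_(i < n) eps * `|a - b|.
  by rewrite sumr_const card_ord -[RHS]mulr_natl mulrA.
apply: ler_sum => k _; rewrite !mxE normrM mulrC.
apply: ler_pM => //; first by apply: le_trans (Gc k); exact: coord_norm_le.
by have := coord_norm_le (a - b) 0 k; rewrite !mxE.
Qed.

End LocalInversion.

(** * Differentiability through one-sided inverses of the derivative *)

Section LocalSurjectivity.
Variable R : realType.
Implicit Types U V W : normedModType R.

Lemma near0_norm_lt (V : normedModType R) (r : R) : 0 < r -> \forall h \near (0 : V), `|h| < r.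
Proof.
move=> r0; apply/nbhs_ballP; exists r => //= h.
by rewrite -ball_normE/= sub0r normrN.
Qed.

Lemma banach_closed_ball m (T : 'rV[R]_m -> 'rV[R]_m) (rho : R) : 0 <= rho ->
  (forall w, `|w| <= rho -> `|T w| <= rho) ->
  (forall a b, `|a| <= rho -> `|b| <= rho -> `|T a - T b| <= 2^-1 * `|a - b|) ->
  exists2 w, `|w| <= rho & T w = w.
Proof.
move=> rho0 TU TL.
pose X : completeNormedModType R :=
  HB.pack 'rV[R]_m (Complete.on 'rV[R]_m) (NormedModule.on 'rV[R]_m).
pose B : set X := [set w | `|w| <= rho].
have TB : {homo T : x / B x >-> B x} by move=> x; exact: TU.
pose f : {fun B >-> B} := mkfun_fun TB.
have cf : is_contraction f.
  exists (2^-1)%:nng; split=> /=; first by rewrite invf_lt1 ?ltr1n.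
  by move=> [a b] [/= ha hb]; exact: TL.
have cB : closed B.
  have -> : B = (fun w : X => `|w|) @^-1` [set x | x <= rho] by [].
  by apply: closed_comp; [move=> x _; exact: norm_continuous|exact: closed_le].
have [|w Bw fw] := banach_fixed_point cf cB.
  by exists 0; rewrite /B/= normr0.
by exists w => //; exact/esym.
Qed.

(* F is inverted along the affine slice y0 + w *m B, on which its derivative at y0
   is the identity, by the contraction w |-> w - F (y0 + w *m B) + z. The linear
   bound on w is what makes h differentiable in descend_differentiable. *)
Lemma local_right_inverse k m (F : 'rV[R]_k -> 'rV[R]_m) (y0 : 'rV[R]_k)
    (B : 'M[R]_(m, k)) : smooth_at F y0 ->
  (forall w, 'D_(w *m B) F y0 = w) ->
  \forall z \near F y0, exists w, F (y0 + w *m B) = z /\ `|w| <= 2 * `|z - F y0|.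
Proof.
move=> sF FB.
pose aff w : 'rV[R]_k := y0 + w *m B.
have saff w : smooth_at aff w.
  apply: smooth_atD; first exact: smooth_at_cst.
  by apply: (@smooth_at_linear _ _ _ (mulmxr B)); exact: linear_rV_continuous.
have aff0 : aff 0 = y0 by rewrite /aff mul0mx addr0.
have Daff v w : 'D_v aff w = v *m B.
  rewrite -[aff]/(cst y0 + mulmxr B) deriveD.
  - rewrite derive_cst add0r (@derive_linear _ _ _ (mulmxr B))//.
    exact: linear_rV_continuous.
  - exact: derivable_cst.
  - apply: diff_derivable; apply: linear_differentiable.
    exact: linear_rV_continuous.
pose G w := w - F (aff w).
have sFa : smooth_at (F \o aff) 0.
  by apply: smooth_at_comp; [exact: fin_dim_rV|exact: saff|rewrite aff0].
have sG : smooth_at G 0.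
  by apply: smooth_atD; [exact: smooth_at_id | exact: smooth_atN].
have DG v : 'D_v G 0 = 0.
  rewrite -[G]/(id - (F \o aff)) deriveB.
  - rewrite derive_id derive_comp; last by rewrite aff0; exact: smooth_at_differentiable.
      by rewrite Daff aff0 FB subrr.
    exact: smooth_at_differentiable (saff 0).
  - exact: derivable_id.
  - by apply: diff_derivable; exact: smooth_at_differentiable.
have G0 : G 0 = - F y0 by rewrite /G aff0 sub0r.
(* Bounding the [m] partial derivatives of [G] by [eps] gives the Lipschitz constant
   [m * eps <= 1/2]; [m.+1] keeps the divisor nonzero when [m = 0]. *)
pose eps : R := (2 * m.+1%:R)^-1.
have eps0 : 0 < eps by rewrite invr_gt0 mulr_gt0.
have : \forall w \near (0 : 'rV[R]_m), differentiable G w /\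
    forall i, `|'D_(delta_mx 0 i) G w| <= eps.
  have nd : \forall w \near (0 : 'rV[R]_m), differentiable G w.
    by apply: filterS (near_smooth_at sG) => w; exact: smooth_at_differentiable.
  have ne : \forall w \near (0 : 'rV[R]_m), forall i, `|'D_(delta_mx 0 i) G w| <= eps.
    apply: (@filter_forall _ _ (fun i w => `|'D_(delta_mx 0 i) G w| <= eps) (nbhs (0 : 'rV[R]_m)) _) => i.
    have /cvgrPdist_le /(_ _ eps0) := smooth_at_continuous (smooth_at_derive (delta_mx 0 i) sG).
    by apply: filterS => w; rewrite DG sub0r normrN.
  exact: filterI nd ne.
move=> /near0_ball[r r0 H].
have lip a b : `|a| < r -> `|b| < r -> `|G a - G b| <= 2^-1 * `|a - b|.
  move=> ar br; apply: le_trans (lipschitz_partials H ar br) _.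
  apply: ler_wpM2r => //; rewrite /eps invfM mulrCA -[leRHS]mulr1.
  by apply: ler_wpM2l; rewrite ?invr_ge0// ler_pdivrMr// mul1r ler_nat.
(* For [z] within [r / 4] of [F y0], the radius [rho = 2 * |z - F y0|] is below [r / 2], so the
   closed ball lies where [G] contracts. *)
have r4 : 0 < r / 4 by rewrite divr_gt0.
near=> z.
have zr : `|z - F y0| < r / 4.
  by near: z; apply/nbhs_ballP; exists (r / 4) => //= z; rewrite -ball_normE/= distrC.
pose rho := 2 * `|z - F y0|.
have rho0 : 0 <= rho by rewrite mulr_ge0.
have rhor : rho < r.
  apply: (@lt_trans _ _ (r / 2)).
    by rewrite /rho mulrC -ltr_pdivlMr// -mulrA -invfM -natrM.
  by rewrite ltr_pdivrMr// mulr_natr mulr2n ltrDl.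
have inr (w : 'rV[R]_m) : `|w| <= rho -> `|w| < r.
  by move=> h; exact: le_lt_trans rhor.
have [w wr|a b ar br|w wr Tw] := @banach_closed_ball m (fun w => G w + z) rho rho0.
(* Both summands are at most [rho / 2], the first by the Lipschitz bound between [w] and 0, the
   second by the choice of [rho]; so the ball is mapped into itself. *)
- have -> : G w + z = (G w - G 0) + (z - F y0) by rewrite G0 opprK addrACA subrr addr0.
  rewrite (le_trans (ler_normD _ _))//.
  have := lip w 0 (inr _ wr); rewrite normr0 => /(_ r0); rewrite subr0.
  rewrite /rho in wr *; lra.
- rewrite opprD addrACA subrr addr0.
  by apply: lip; exact: inr.
- exists w; split=> //; rewrite -[y0 + _]/(aff w).
  apply/esym/eqP; rewrite -subr_eq0; apply/eqP/(addrI w).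
  by rewrite addr0 -[RHS]Tw /G addrA addrAC.
Unshelve. all: by end_near. Qed.

(** The candidate differential sends v to d(h o F)(v B). For small v there is w with F(y0 + w B) =
    F(y0) + v, so the increment of h is one of h o F. What remains is the linearisation error of h o
    F at w B and the image of v - w, which is the linearisation error of F; since |w| <= 2 |v|, both
    are o(|v|). *)
Lemma descend_differentiable k m (F : 'rV[R]_k -> 'rV[R]_m) (y0 : 'rV[R]_k)
    (B : 'M[R]_(m, k)) (h : 'rV[R]_m -> R) : smooth_at F y0 ->
  (forall w, 'D_(w *m B) F y0 = w) ->
  differentiable (h \o F) y0 -> differentiable h (F y0).
Proof.
move=> sF FB dh.
have lc := diff_continuous dh.
pose L : {linear 'rV[R]_m -> R^o} := 'd (h \o F) y0 \o mulmxr B.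
have Lc : continuous L by exact: linear_rV_continuous.
have [C1 C10 b1] := linear_bound Lc.
have [C2 C20 b2] := @linear_bound _ _ _ (mulmxr B) (@linear_rV_continuous _ _ _ (mulmxr B)).
suff [] : differentiable h (F y0) /\ forall v, 'd h (F y0) v = L v by [].
apply: differentiable_eps => // e e0.
(* As [|w B| <= 2 * C2 * |v|], these constants make each of the two errors at most [e / 2 * |v|]. *)
pose e1 := e / (4 * C2); pose e2 := e / (4 * C1) / C2.
have e10 : 0 < e1 by rewrite divr_gt0// mulr_gt0.
have e20 : 0 < e2 by rewrite !divr_gt0// mulr_gt0.
have n1 := differentiable_near_le dh e10.
have n2 := differentiable_near_le (smooth_at_differentiable sF) e20.
have [r r0 H] := near0_ball (filterI n1 n2).
have rC : 0 < r / (4 * C2) by rewrite divr_gt0// mulr_gt0.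
have := near0_shift (local_right_inverse sF FB); apply: filter_app.
near=> v => -[w [Fw wv]].
rewrite addrK in wv.
have vr : `|v| < r / (4 * C2) by near: v; exact: (@near0_norm_lt 'rV[R]_m).
have wB : `|w *m B| <= C2 * `|w| := b2 w.
have wB2 : `|w *m B| <= C2 * (2 * `|v|).
  by apply: le_trans wB _; rewrite ler_pM2l.
have wr : `|w *m B| < r.
  apply: le_lt_trans wB _; apply: le_lt_trans (ler_wpM2l (ltW C20) wv) _.
  rewrite ltr_pdivlMr ?mulr_gt0// in vr.
  have : 0 <= `|v| * C2 by rewrite mulr_ge0// ltW.
  lra.
have [H1 H2] := H _ wr; rewrite /= in H1 H2.
rewrite [w *m B + y0]addrC Fw in H1 H2.
have E2 : 'd F y0 (w *m B) = w by rewrite -deriveE//; exact: smooth_at_differentiable.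
rewrite addrK E2 in H2.
have -> : h (v + F y0) - h (F y0) - L v =
   (h (v + F y0) - h (F y0) - 'd (h \o F) y0 (w *m B)) - L (v - w).
  rewrite (linearB L) -[L w]/('d (h \o F) y0 (w *m B)) opprB addrA.
  by rewrite subrK.
rewrite (le_trans (ler_normB _ _))// (splitr e) mulrDl; apply: lerD.
  apply: le_trans H1 _; apply: le_trans (ler_wpM2l (ltW e10) wB2) _.
  have -> // : e1 * (C2 * (2 * `|v|)) = e / 2 * `|v|.
  by rewrite /e1; field; rewrite gt_eqF.
apply: le_trans (b1 _) _; apply: le_trans (ler_wpM2l (ltW C10) H2) _.
apply: le_trans (ler_wpM2l (ltW C10) (ler_wpM2l (ltW e20) wB2)) _.
have -> // : C1 * (e2 * (C2 * (2 * `|v|))) = e / 2 * `|v|.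
by rewrite /e2; field; rewrite !gt_eqF.
Unshelve. all: by end_near. Qed.

(** The map b = (phi o g) B is differentiable, and increments of b and g differ by at most e1 times
    the increment of g, because B inverts the derivative of phi; continuity of g puts its increments
    where this holds. With e1 = 1/2 the increment of g is absorbed and bounded linearly in h; a
    smaller e1 then gives the little-o. *)
Lemma lift_differentiable V k n (phi : 'rV[R]_k -> 'rV[R]_n)
    (B : 'M[R]_(n, k)) (g : V -> 'rV[R]_k) (t0 : V) :
  differentiable phi (g t0) -> (forall v, 'D_v phi (g t0) *m B = v) ->
  {for t0, continuous g} -> differentiable (phi \o g) t0 ->
  differentiable g t0.
Proof.
move=> dphi phiB cg dpg.
have Bc : continuous (mulmxr B : {linear 'rV[R]_n -> 'rV[R]_k}).
  exact: linear_rV_continuous.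
pose b := mulmxr B \o (phi \o g).
have db : differentiable b t0.
  by apply: differentiable_comp => //; exact: linear_differentiable.
have [C2 C20 b2] := linear_bound Bc.
pose L : {linear V -> 'rV[R]_k} := 'd b t0.
have Lc : continuous L by exact: diff_continuous.
have [C C0 bL] := linear_bound Lc.
suff [] : differentiable g t0 /\ forall v, 'd g t0 v = L v by [].
apply: differentiable_eps => // e e0.
have key (e1 : R) : 0 < e1 -> \forall h \near (0 : V),
    `|b (h + t0) - b t0 - (g (h + t0) - g t0)| <= e1 * `|g (h + t0) - g t0|.
  move=> e10; have e1C : 0 < e1 / C2 by rewrite divr_gt0.
  have [r r0 H] := near0_ball (differentiable_near_le dphi e1C).
  have /cvgrPdist_lt /(_ _ r0) := cg => /near0_shift; apply: filterS => h hr.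
  rewrite distrC in hr; have := H _ hr; rewrite subrK => H1.
  rewrite /b/= -mulmxBl.
  have E : 'd phi (g t0) (g (h + t0) - g t0) *m B = g (h + t0) - g t0.
    by rewrite -deriveE.
  rewrite -[X in _ - X]E -mulmxBl; apply: le_trans (b2 _) _.
  by rewrite mulrC -ler_pdivlMr// mulrAC.
have h20 : 0 < 2^-1 :> R by rewrite invr_gt0.
have K := key _ h20.
(* From |y| <= |x| + |y| / 2 and |x| <= (C + 1) |h|, where x and y are the increments of [b] and
   [g]. *)
pose D := 2 * (C + 1).
have D0 : 0 < D by rewrite mulr_gt0// addr_gt0.
have e20 : 0 < e / (2 * D) by rewrite divr_gt0// mulr_gt0.
have e30 : 0 < e / 2 by rewrite divr_gt0.
have K2 := key _ e20.
have N1 := differentiable_near_le db ltr01.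
have N2 := differentiable_near_le db e30.
near=> h.
have k1 : `|b (h + t0) - b t0 - (g (h + t0) - g t0)| <= 2^-1 * `|g (h + t0) - g t0|.
  by near: h; exact: K.
have k2 : `|b (h + t0) - b t0 - (g (h + t0) - g t0)| <= e / (2 * D) * `|g (h + t0) - g t0|.
  by near: h; exact: K2.
have k3 : `|b (h + t0) - b t0 - L h| <= 1 * `|h| by near: h; exact: N1.
have k4 : `|b (h + t0) - b t0 - L h| <= e / 2 * `|h| by near: h; exact: N2.
have gD : `|g (h + t0) - g t0| <= D * `|h|.
  move: (bL h) k1 k3; set x := b _ - b _; set y := g _ - g _ => p1 p2 p3.
  have q1 : `|y| <= `|x| + `|x - y| by rewrite -{1}(subKr x y); exact: ler_normB.
  have q2 : `|x| <= `|L h| + `|x - L h| by rewrite -{1}(subrK (L h) x) addrC; exact: ler_normD.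
  rewrite /D; lra.
have -> : g (h + t0) - g t0 - L h = (b (h + t0) - b t0 - L h) -
     (b (h + t0) - b t0 - (g (h + t0) - g t0)).
  by rewrite opprB [RHS]addrC addrA subrK.
rewrite (le_trans (ler_normB _ _))// (splitr e) mulrDl; apply: lerD => //.
apply: le_trans k2 _; rewrite invfM mulrA -mulrA ler_pM2l//.
by rewrite ler_pdivrMl.
Unshelve. all: by end_near. Qed.

End LocalSurjectivity.

(** * Calculus on manifolds *)

Section ManifoldCalculus.
Variable R : realType.
Implicit Types V W : normedModType R.

(** The source is an arbitrary normed space so that curves, inverse charts and the action read in a
    product of two charts share one calculus. By [smooth_into_chart], testing a single chart around
    [g v] is enough. *)
Definition smooth_into V n (T : topologicalType) (S : manifold_on R n T)
    (g : V -> T) (v : V) :=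
  {for v, continuous g} /\ forall q, cdom (chart_at S q) (g v) ->
    smooth_at (cmap (chart_at S q) \o g) v.

(** The target coordinates are those of the chart at [g v], the convention of [mdiff] and
    [velocity]; with [V = R] and [w = 1] it is [velocity]. *)
Definition tangent_map V n (T : topologicalType) (S : manifold_on R n T)
    (g : V -> T) (v w : V) : 'rV[R]_n :=
  'D_w (cmap (chart_at S (g v)) \o g) v.

Lemma open_preimage_within (T1 T2 : topologicalType) (A : set T1) (B : set T2)
    (f : T1 -> T2) : open A -> open B ->
  (forall x, A x -> {for x, continuous f}) -> open (A `&` f @^-1` B).
Proof.
move=> oA oB cf; rewrite openE => x [Ax Bfx]; rewrite /interior.
apply: filterI; first exact: open_nbhs_nbhs.
by apply: (cf _ Ax); exact: open_nbhs_nbhs.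
Qed.

Lemma near_in_open (T1 T2 : topologicalType) (f : T1 -> T2) (x : T1) (B : set T2) :
  {for x, continuous f} -> open B -> B (f x) -> \forall y \near x, B (f y).
Proof. by move=> cf oB Bfx; apply: cf; exact: open_nbhs_nbhs. Qed.

Section OneManifold.
Variables (n : nat) (T : topologicalType) (S : manifold_on R n T).
Notation ch := (chart_at S).

Lemma smooth_at_transition p q (y : 'rV[R]_n) : ccod (ch p) y ->
  cdom (ch q) (cinv (ch p) y) -> smooth_at (cmap (ch q) \o cinv (ch p)) y.
Proof.
move=> py qy; apply: (smooth_on_at _ (@chart_at_compat _ _ _ S p q)) => //.
apply: open_preimage_within; [exact: ccod_open | exact: cdom_open |].
by move=> z; exact: cinv_continuous.
Qed.

Lemma smooth_into_cinv p (y : 'rV[R]_n) : ccod (ch p) y ->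
  smooth_into S (cinv (ch p)) y.
Proof.
by move=> py; split=> [|q]; [exact: cinv_continuous | exact: smooth_at_transition].
Qed.

Lemma near_eq_cinv_cmap V (g : V -> T) v p : {for v, continuous g} ->
  cdom (ch p) (g v) -> \forall v' \near v, cinv (ch p) (cmap (ch p) (g v')) = g v'.
Proof.
move=> cg pv; apply: filterS (near_in_open cg (cdom_open (ch p)) pv) => v'.
exact: cmapK.
Qed.

Lemma smooth_into_chart V (g : V -> T) v p : {for v, continuous g} ->
  cdom (ch p) (g v) -> smooth_at (cmap (ch p) \o g) v -> smooth_into S g v.
Proof.
move=> cg pv sg; split=> // q qv.
have st : smooth_at (cmap (ch q) \o cinv (ch p)) (cmap (ch p) (g v)).
  by apply: smooth_at_transition; [exact: cmap_cod | rewrite cmapK].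
have := smooth_at_comp (fin_dim_rV R n) sg st.
by apply: smooth_at_eq; apply: filterS (near_eq_cinv_cmap cg pv) => v' /= ->.
Qed.

Lemma near_smooth_into V (g : V -> T) v : smooth_into S g v ->
  \forall v' \near v, smooth_into S g v'.
Proof.
move=> [cg sg]; pose p := g v.
have pv : cdom (ch p) (g v) by exact: chart_at_dom.
have [U [oU Uv] UE] := near_open (near_eq_cinv_cmap cg pv).
have [U' [oU' U'v] U'E] := near_open (near_in_open cg (cdom_open (ch p)) pv).
have nU := open_nbhs_nbhs (conj oU Uv).
have nU' := open_nbhs_nbhs (conj oU' U'v).
near=> v'.
have sg' : smooth_at (cmap (ch p) \o g) v'.
  by near: v'; apply: near_smooth_at; exact: sg.
have Uv' : U v' by near: v'.
have U'v' : U' v' by near: v'.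
have pv' : cdom (ch p) (g v') := U'E _ U'v'.
apply: (@smooth_into_chart _ _ _ p) => //.
(* [smooth_into] records continuity of [g] at [v] only; at a nearby [v'] it is recovered from the
   coordinate expression, which is smooth there. *)
have c : {for v', continuous (cinv (ch p) \o (cmap (ch p) \o g))}.
  apply: continuous_comp; first exact: smooth_at_continuous.
  by apply: cinv_continuous; exact: cmap_cod.
have E : \forall z \near v', (cinv (ch p) \o (cmap (ch p) \o g)) z = g z.
  by apply: filterS (open_nbhs_nbhs (conj oU Uv')) => z /UE.
move: c; rewrite /prop_for /continuous_at (nbhs_singleton E).
by apply: cvg_trans; apply: near_eq_cvg.
Unshelve. all: by end_near. Qed.

Lemma derive_chart_comp V W (f : T -> W) (g : V -> T) (v w : V) p :
  smooth_into S g v -> cdom (ch p) (g v) ->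
  smooth_at (f \o cinv (ch p)) (cmap (ch p) (g v)) ->
  'D_w (f \o g) v =
  'D_('D_w (cmap (ch p) \o g) v) (f \o cinv (ch p)) (cmap (ch p) (g v)).
Proof.
move=> [cg sg] pv sf.
rewrite -(@derive_comp _ _ _ _ (cmap (ch p) \o g) (f \o cinv (ch p))).
- apply: near_eq_derive.
  by apply: filterS (near_eq_cinv_cmap cg pv) => v' /= ->.
- by apply: smooth_at_differentiable; exact: sg.
- exact: smooth_at_differentiable.
Qed.

Lemma derive_chart_change V (g : V -> T) (v w : V) p q :
  smooth_into S g v -> cdom (ch p) (g v) -> cdom (ch q) (g v) ->
  'D_w (cmap (ch q) \o g) v =
  'D_('D_w (cmap (ch p) \o g) v) (cmap (ch q) \o cinv (ch p)) (cmap (ch p) (g v)).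
Proof.
move=> sg pv qv; apply: derive_chart_comp => //.
by apply: smooth_at_transition; [exact: cmap_cod | rewrite cmapK].
Qed.

Lemma derive_cmap_cinv p (y v : 'rV[R]_n) : ccod (ch p) y ->
  'D_v (cmap (ch p) \o cinv (ch p)) y = v.
Proof.
move=> py; rewrite (@near_eq_derive _ _ _ _ (@idfun 'rV[R]_n)).
  exact: derive_id.
have nU := open_nbhs_nbhs (conj (@ccod_open _ _ _ (ch p)) py).
by apply: filterS nU => z /= /cinvK.
Qed.

Lemma tangent_map_cinv x (v : 'rV[R]_n) : tangent_map S (cinv (ch x)) (cmap (ch x) x) v = v.
Proof.
have xx : cdom (ch x) x := chart_at_dom S x.
by rewrite /tangent_map cmapK// derive_cmap_cinv//; exact: cmap_cod.
Qed.

(** The inner derivative passes from the chart at [x] to the chart of index [p], and the inverse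
    chart passes back. Since [vfield_in] is such an inner derivative, this recovers a field from its
    coordinates in any chart. *)
Lemma tangent_map_cinvK p (y u : 'rV[R]_n) : ccod (ch p) y ->
  let x := cinv (ch p) y in
  tangent_map S (cinv (ch p)) y ('D_u (cmap (ch p) \o cinv (ch x)) (cmap (ch x) x)) = u.
Proof.
move=> py x; have xx : cdom (ch x) x := chart_at_dom S x.
have px : cdom (ch p) x by exact: cinv_dom.
have cx : ccod (ch x) (cmap (ch x) x) by exact: cmap_cod.
have xK : cinv (ch x) (cmap (ch x) x) = x by exact: cmapK.
have := @derive_chart_change _ (cinv (ch x)) (cmap (ch x) x) u p x
  (smooth_into_cinv cx).
rewrite xK derive_cmap_cinv// => /(_ px xx) E.
by rewrite [RHS]E {4}/x cinvK.
Qed.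

Lemma fdiff_tangent_map V (h : T -> R) (g : V -> T) (v w : V) :
  smooth_fun S h -> smooth_into S g v -> fdiff S h (g v) (tangent_map S g v w) = 'D_w (h \o g) v.
Proof.
move=> sh sg; have xx := chart_at_dom S (g v).
rewrite /fdiff /tangent_map -(derive_chart_comp w sg)//.
apply: (smooth_on_at _ (sh (g v))); first exact: ccod_open.
exact: cmap_cod.
Qed.

Lemma smooth_fun_comp V (h : T -> R) (g : V -> T) (v : V) :
  smooth_fun S h -> smooth_into S g v -> smooth_at (h \o g) v.
Proof.
move=> sh [cg sg]; have xx := chart_at_dom S (g v).
have s1 : smooth_at (h \o cinv (ch (g v))) (cmap (ch (g v)) (g v)).
  apply: (smooth_on_at _ (sh (g v))); first exact: ccod_open.
  exact: cmap_cod.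
have := smooth_at_comp (fin_dim_rV R n) (sg _ xx) s1.
apply: smooth_at_eq.
by apply: filterS (near_eq_cinv_cmap cg xx) => v' /= ->.
Qed.

Lemma smooth_curve_into (c : R -> T) :
  (forall t, smooth_into S c t) <-> smooth_curve S c.
Proof.
split=> [sc|[cc sc] t].
  split=> [t|p]; first exact: (sc t).1.
  by apply: smooth_at_on => t /= /(sc t).2.
split=> [|q qt]; first exact: cc.
apply: (smooth_on_at _ (sc q)) qt.
by apply: open_comp; [move=> ? _; exact: cc | exact: cdom_open].
Qed.

End OneManifold.

Section Maps.
Variables (n1 n2 n3 : nat) (T1 T2 T3 : topologicalType).
Variables (S1 : manifold_on R n1 T1) (S2 : manifold_on R n2 T2).
Variable (S3 : manifold_on R n3 T3).

Lemma smooth_map_at (f : T1 -> T2) p q y : smooth_map S1 S2 f ->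
  ccod (chart_at S1 p) y -> cdom (chart_at S2 q) (f (cinv (chart_at S1 p) y)) ->
  smooth_at (cmap (chart_at S2 q) \o f \o cinv (chart_at S1 p)) y.
Proof.
move=> [cf sf] py qy; apply: (smooth_on_at _ (sf p q)) => //.
apply: (@open_preimage_within _ _ _ _ (f \o cinv (chart_at S1 p))).
- exact: ccod_open.
- exact: cdom_open.
- by move=> z pz; apply: continuous_comp; [exact: cinv_continuous | exact: cf].
Qed.

Lemma smooth_map_into V (f : T1 -> T2) (g : V -> T1) v :
  smooth_map S1 S2 f -> smooth_into S1 g v -> smooth_into S2 (f \o g) v.
Proof.
move=> sf sg; have [cg cmg] := sg; split.
  by apply: continuous_comp => //; exact: sf.1.
move=> q qv; have xx := chart_at_dom S1 (g v).
have s1 : smooth_at (cmap (chart_at S2 q) \o f \o cinv (chart_at S1 (g v)))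
                    (cmap (chart_at S1 (g v)) (g v)).
  by apply: smooth_map_at => //; [exact: cmap_cod | rewrite cmapK].
have := smooth_at_comp (fin_dim_rV R n1) (cmg _ xx) s1.
apply: smooth_at_eq.
by apply: filterS (near_eq_cinv_cmap cg xx) => v' /= ->.
Qed.

Lemma mdiff_tangent_map V (f : T1 -> T2) (g : V -> T1) v w :
  smooth_map S1 S2 f -> smooth_into S1 g v ->
  mdiff S1 S2 f (g v) (tangent_map S1 g v w) = tangent_map S2 (f \o g) v w.
Proof.
move=> sf sg; have xx := chart_at_dom S1 (g v).
rewrite /mdiff /tangent_map.
have s1 : smooth_at ((cmap (chart_at S2 (f (g v))) \o f) \o cinv (chart_at S1 (g v)))
                    (cmap (chart_at S1 (g v)) (g v)).
  apply: smooth_map_at => //; first exact: cmap_cod.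
  by rewrite cmapK//; exact: chart_at_dom.
by rewrite -(derive_chart_comp w sg xx s1).
Qed.

Lemma smooth_map2_into V (f : T1 -> T2 -> T3) (g1 : V -> T1) (g2 : V -> T2) v :
  smooth_map2 S1 S2 S3 f -> smooth_into S1 g1 v -> smooth_into S2 g2 v ->
  smooth_into S3 (fun v' => f (g1 v') (g2 v')) v.
Proof.
move=> [cf sf] [cg1 sg1] [cg2 sg2]; split.
  apply: (@continuous_comp _ _ _ (fun v' => (g1 v', g2 v')) (fun xy => f xy.1 xy.2)).
    exact: cvg_pair.
  exact: cf.
move=> r rv; pose p := g1 v; pose q := g2 v.
have pv : cdom (chart_at S1 p) (g1 v) := chart_at_dom S1 _.
have qv : cdom (chart_at S2 q) (g2 v) := chart_at_dom S2 _.
pose F (y : 'rV[R]_n1 * 'rV[R]_n2) :=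
  f (cinv (chart_at S1 p) y.1) (cinv (chart_at S2 q) y.2).
have sF : smooth_at (cmap (chart_at S3 r) \o F)
   (cmap (chart_at S1 p) (g1 v), cmap (chart_at S2 q) (g2 v)).
  apply: (smooth_on_at _ (sf p q r)); last first.
    by split=> /=; rewrite ?cmapK//; exact: cmap_cod.
  have -> : [set y | [/\ ccod (chart_at S1 p) y.1, ccod (chart_at S2 q) y.2 &
       cdom (chart_at S3 r) (f (cinv (chart_at S1 p) y.1) (cinv (chart_at S2 q) y.2))]] =
     (ccod (chart_at S1 p) `*` ccod (chart_at S2 q)) `&` F @^-1` cdom (chart_at S3 r).
    by apply/seteqP; split=> y /= => [[]|[[]]].
  apply: open_preimage_within.
  - apply: (@openI _ (fst @^-1` ccod (chart_at S1 p)) (snd @^-1` ccod (chart_at S2 q))).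
      by apply: open_comp; [move=> z _; exact: cvg_fst | exact: ccod_open].
    by apply: open_comp; [move=> z _; exact: cvg_snd | exact: ccod_open].
  - exact: cdom_open.
  - move=> y [/= y1 y2].
    have h1 : {for y, continuous (cinv (chart_at S1 p) \o fst)}.
      by apply: continuous_comp; [exact: cvg_fst | exact: cinv_continuous].
    have h2 : {for y, continuous (cinv (chart_at S2 q) \o snd)}.
      by apply: continuous_comp; [exact: cvg_snd | exact: cinv_continuous].
    have h3 : {for y, continuous (fun y : 'rV[R]_n1 * 'rV[R]_n2 =>
        (cinv (chart_at S1 p) y.1, cinv (chart_at S2 q) y.2))}.
      exact: (cvg_pair h1 h2).
    exact: (continuous_comp h3 (cf _)).
have sp := smooth_at_pair (sg1 _ pv) (sg2 _ qv).
have := smooth_at_comp (fin_dim_prod (fin_dim_rV R n1) (fin_dim_rV R n2)) sp sF.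
apply: smooth_at_eq.
have e1 := near_eq_cinv_cmap cg1 pv.
have e2 := near_eq_cinv_cmap cg2 qv.
apply: filterS (filterI e1 e2) => v' [h1 h2].
by rewrite /F /= h1 h2.
Qed.

End Maps.

Lemma smooth_into_cst V n (T : topologicalType) (S : manifold_on R n T) (x : T) (v : V) :
  smooth_into S (fun _ => x) v.
Proof. by split=> [|q _]; [exact: cvg_cst | exact: smooth_at_cst]. Qed.

Lemma tangent_map_cst V n (T : topologicalType) (S : manifold_on R n T) (x : T) (v w : V) :
  tangent_map S (fun _ => x) v w = 0.
Proof. exact: derive_cst. Qed.

End ManifoldCalculus.

(** * Pull-backs of 1-forms and the exterior derivative *)

Section Forms.
Variable R : realType.
Implicit Types V W : normedModType R.
Variables (n : nat) (T : topologicalType) (S : manifold_on R n T).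
Variable eta : T -> {scalar 'rV[R]_n}.
Notation ch := (chart_at S).

Definition pform V (g : V -> T) (w v : V) : R := eta (g v) (tangent_map S g v w).

Lemma pform_form_in V (g : V -> T) (w v : V) p :
  smooth_into S g v -> cdom (ch p) (g v) ->
  pform g w v = form_in S eta p ('D_w (cmap (ch p) \o g) v) (cmap (ch p) (g v)).
Proof.
move=> sg pv; rewrite /form_in cmapK//; congr (eta _ _).
by rewrite /tangent_map; apply: derive_chart_change => //; exact: chart_at_dom.
Qed.

Lemma form_in_sum p (u y : 'rV[R]_n) : ccod (ch p) y ->
  form_in S eta p u y = \sum_i u 0 i * form_in S eta p (delta_mx 0 i) y.
Proof.
move=> py; rewrite /form_in.
have d : differentiable (cmap (ch (cinv (ch p) y)) \o cinv (ch p)) y.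
  apply: smooth_at_differentiable; apply: smooth_at_transition => //.
  exact: chart_at_dom.
rewrite {1}(row_sum_delta u) derive_sum_dir// linear_sum.
by apply: eq_bigr => i _; rewrite linearZ.
Qed.

Hypothesis smooth_eta : smooth_form S eta.

Lemma smooth_at_form_in p v y : ccod (ch p) y ->
  smooth_at (form_in S eta p v) y.
Proof.
by move=> py; apply: (smooth_on_at _ (smooth_eta p v)) => //; exact: ccod_open.
Qed.

(** [pform] uses the chart at [g z], which jumps with [z]. In the fixed chart [p] it becomes a
    combination of smooth functions that can be differentiated in [z]. *)
Lemma pform_sum V (g : V -> T) (w v : V) p :
  smooth_into S g v -> cdom (ch p) (g v) ->
  \forall z \near v, pform g w z =
    \sum_i ('D_w (cmap (ch p) \o g) z) 0 i *
      form_in S eta p (delta_mx 0 i) (cmap (ch p) (g z)).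
Proof.
move=> sg pv; have n1 := near_smooth_into sg.
have n2 := near_in_open sg.1 (cdom_open (ch p)) pv.
apply: filterS (filterI n1 n2) => z [sz pz].
by rewrite (pform_form_in _ sz pz) form_in_sum//; exact: cmap_cod.
Qed.

Lemma smooth_at_pform V (g : V -> T) (w v : V) :
  smooth_into S g v -> smooth_at (pform g w) v.
Proof.
move=> sg; pose p := g v; have pv : cdom (ch p) (g v) := chart_at_dom S _.
have n1 := pform_sum w sg pv.
have h : smooth_at (fun z => \sum_i ('D_w (cmap (ch p) \o g) z) 0 i *
      form_in S eta p (delta_mx 0 i) (cmap (ch p) (g z))) v.
  apply: smooth_at_sum => i; apply: smooth_atM.
    by apply/smooth_at_coord/smooth_at_derive; exact: sg.2.
  have se : smooth_at (form_in S eta p (delta_mx 0 i)) ((cmap (ch p) \o g) v).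
    by apply: smooth_at_form_in; exact: cmap_cod.
  exact: (smooth_at_comp (fin_dim_rV R n) (sg.2 _ pv) se).
by apply: smooth_at_eq h; apply: filterS n1 => z ->.
Qed.

Lemma derive_form_in p (u v y : 'rV[R]_n) : ccod (ch p) y ->
  'D_v (form_in S eta p u) y =
  \sum_i u 0 i * 'D_v (form_in S eta p (delta_mx 0 i)) y.
Proof.
move=> py; have nU := open_nbhs_nbhs (conj (@ccod_open _ _ _ (ch p)) py).
have d i : derivable (form_in S eta p (delta_mx 0 i)) y v.
  by apply: diff_derivable; apply/smooth_at_differentiable/smooth_at_form_in.
rewrite (@near_eq_derive _ _ _ _
  (\sum_i (u 0 i *: form_in S eta p (delta_mx 0 i)))).
  rewrite derive_sum => [|i]; last exact: derivableZ.
  by apply: eq_bigr => i _; rewrite deriveZ.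
by apply: filterS nU => z pz; rewrite form_in_sum// fct_sumE.
Qed.

(** Product rule in the chart [p]: the sum carries the second derivative of [F], symmetric in [u]
    and [w], and the last term differentiates the form in a frozen direction, which is what [ext_d]
    antisymmetrises. *)
Lemma derive_pform V (g : V -> T) (u w v : V) p :
  smooth_into S g v -> cdom (ch p) (g v) ->
  let F := cmap (ch p) \o g in
  'D_u (pform g w) v =
  \sum_i ('D_u ('D_w F) v) 0 i * form_in S eta p (delta_mx 0 i) (F v) +
  'D_('D_u F v) (form_in S eta p ('D_w F v)) (F v).
Proof.
move=> sg pv F; rewrite (near_eq_derive _ (pform_sum w sg pv)).
have pF : ccod (ch p) (F v) by exact: cmap_cod.
have sF : smooth_at F v := sg.2 _ pv.
have d1 i : differentiable (fun z => ('D_w F z) 0 i) v.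
  by apply/smooth_at_differentiable/smooth_at_coord/smooth_at_derive.
have d3 i : differentiable (form_in S eta p (delta_mx 0 i)) (F v).
  by apply/smooth_at_differentiable/smooth_at_form_in.
have d2 i : differentiable (form_in S eta p (delta_mx 0 i) \o F) v.
  by apply: differentiable_comp => //; exact: smooth_at_differentiable.
have -> : (fun z => \sum_i ('D_w F z) 0 i * form_in S eta p (delta_mx 0 i) (cmap (ch p) (g z))) =
   \sum_i ((fun z => ('D_w F z) 0 i) * (form_in S eta p (delta_mx 0 i) \o F)).
  by apply/funext => z; rewrite fct_sumE.
rewrite derive_sum => [|i]; last first.
  by apply: derivableM; exact: diff_derivable.
rewrite derive_form_in// -big_split/=; apply: eq_bigr => i _.
rewrite deriveM; [|exact: diff_derivable|exact: diff_derivable].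
rewrite derive_coord; last by apply/smooth_at_differentiable/smooth_at_derive.
rewrite derive_comp//; last exact: smooth_at_differentiable.
rewrite addrC; congr (_ + _); exact: mulrC.
Qed.

(* [pform S eta g w] is the pull-back of eta by g evaluated on the constant vector
   field w of V; the second derivatives of g cancel by symmetry. *)
Lemma ext_d_pform V (g : V -> T) (u w v : V) : smooth_into S g v ->
  'D_u (pform g w) v - 'D_w (pform g u) v =
  ext_d S eta (g v) (tangent_map S g v u) (tangent_map S g v w).
Proof.
move=> sg; have pv := chart_at_dom S (g v).
rewrite (derive_pform _ _ sg pv) (derive_pform _ _ sg pv) /=.
rewrite (deriveC _ _ (sg.2 _ pv)) opprD addrACA subrr add0r.
by [].
Qed.

Lemma ext_dDl x (u u' v : 'rV[R]_n) :
  ext_d S eta x (u + u') v = ext_d S eta x u v + ext_d S eta x u' v.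
Proof.
have px := cmap_cod (chart_at_dom S x).
have d w : differentiable (form_in S eta x w) (cmap (ch x) x).
  by apply/smooth_at_differentiable/smooth_at_form_in.
rewrite /ext_d deriveD_dir// addrACA -opprD; congr (_ - _).
rewrite !(derive_form_in _ _ px) -big_split/=.
by apply: eq_bigr => i _; rewrite mxE mulrDl.
Qed.

Lemma ext_dZl x (k : R) (u v : 'rV[R]_n) :
  ext_d S eta x (k *: u) v = k * ext_d S eta x u v.
Proof.
have px := cmap_cod (chart_at_dom S x).
have d w : differentiable (form_in S eta x w) (cmap (ch x) x).
  by apply/smooth_at_differentiable/smooth_at_form_in.
rewrite /ext_d deriveZ_dir// mulrBr; congr (_ - _).
rewrite !(derive_form_in _ _ px) big_distrr/=.
by apply: eq_bigr => i _; rewrite mxE mulrA.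
Qed.

Lemma ext_dC x (u v : 'rV[R]_n) : ext_d S eta x u v = - ext_d S eta x v u.
Proof. by rewrite /ext_d opprB. Qed.

End Forms.

(** * Nondegeneracy of contact forms *)

Section AlternatingForms.
Variable R : fieldType.

Definition update_at (I : eqType) (T : Type) (v : I -> T) (j : I) (z : T) : I -> T :=
  fun i => if i == j then z else v i.

(** Putting a combination of the [v i] in slot j multiplies [omega v] by the j-th coefficient, the
    other terms having a repeated argument. Applied to a linear relation this shows that [v] is a
    basis; applied to the expansion of [z], that all its coefficients vanish. *)
Lemma alternating_nondegenerate N (omega : ('I_N -> 'rV[R]_N) -> R)
    (v : 'I_N -> 'rV[R]_N) (z : 'rV[R]_N) :
  (forall v j k u w, omega (update_at v j (k *: u + w)) =
     k * omega (update_at v j u) + omega (update_at v j w)) ->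
  (forall v i j, i != j -> v i = v j -> omega v = 0) ->
  omega v != 0 -> (forall j, omega (update_at v j z) = 0) -> z = 0.
Proof.
move=> lin alt v0 zv.
have om0 j : omega (update_at v j 0) = 0.
  have := lin v j 1 0 0; rewrite scaler0 addr0 mul1r.
  by move/(canLR (addrK _)); rewrite subrr.
have sumE j (c : 'I_N -> R) (u : 'I_N -> 'rV[R]_N) (s : seq 'I_N) :
    omega (update_at v j (\sum_(i <- s) c i *: u i)) =
    \sum_(i <- s) c i * omega (update_at v j (u i)).
  elim: s => [|i s IH]; first by rewrite !big_nil.
  by rewrite !big_cons lin IH.
have coef (c : 'rV[R]_N) : (forall j, omega (update_at v j (\sum_i c 0 i *: v i)) = 0) -> c = 0.
  move=> h; apply/rowP => j; rewrite mxE; apply/eqP.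
  have := h j; rewrite sumE (bigD1 j)//= big1 ?addr0 => [|i ij]; last first.
    rewrite (alt _ i j) ?mulr0//.
    by rewrite /update_at eqxx (negPf ij).
  have -> : update_at v j (v j) = v.
    by apply/funext => i; rewrite /update_at; case: eqP => [->|].
  by move/eqP; rewrite mulf_eq0 (negPf v0) orbF.
pose A : 'M[R]_N := \matrix_i v i.
have mulA (c : 'rV[R]_N) : c *m A = \sum_i c 0 i *: v i.
  by rewrite mulmx_sum_row; apply: eq_bigr => i _; rewrite rowK.
have Afree : row_free A.
  rewrite -kermx_eq0; apply/eqP/row_matrixP => i; rewrite row0.
  apply: coef => j; rewrite -mulA.
  have -> : row i (kermx A) *m A = 0 by rewrite -row_mul mulmx_ker row0.
  exact: om0.
have Au : A \in unitmx by rewrite -row_free_unit.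
have zE : z = (z *m invmx A) *m A by rewrite mulmxKV.
have c0 : z *m invmx A = 0 by apply: coef => j; rewrite -mulA -zE.
by rewrite zE c0 mul0mx.
Qed.

End AlternatingForms.

Section ContactNondegeneracy.
Variables (R : realType) (n : nat) (T : topologicalType).
Variable S : manifold_on R n.*2.+1 T.
Variable eta : T -> {scalar 'rV[R]_(n.*2.+1)}.
Hypothesis smooth_eta : smooth_form S eta.

Let odd_index : 'I_n -> 'I_(n.*2.+1) := locked (fun i => inord i.*2.+1).
Let even_index : 'I_n -> 'I_(n.*2.+1) := locked (fun i => inord i.*2.+2).

Let odd_indexE i : odd_index i = i.*2.+1 :> nat.
Proof. by rewrite /odd_index -lock inordK// !ltnS ltn_double. Qed.

Let even_indexE i : even_index i = i.*2.+2 :> nat.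
Proof. by rewrite /even_index -lock inordK// !ltnS ltn_Sdouble. Qed.

(** Slot 0 feeds [eta], and every other slot is the left or the right argument of exactly one factor
    [ext_d] in a term of [contact_volume]. *)
Lemma ordinal_doubleP (k : 'I_(n.*2.+1)) :
  [\/ k = ord0, exists i, k = odd_index i | exists i, k = even_index i].
Proof.
case: k => -[|k] kn; first by apply: Or31; exact: val_inj.
have k2 : (k./2 < n)%N by rewrite ltn_half_double.
have := odd_double_half k; case: (odd k) => kE.
  apply: Or33; exists (Ordinal k2); apply: ord_inj.
  by rewrite even_indexE/= -[in LHS]kE.
apply: Or32; exists (Ordinal k2); apply: ord_inj.
by rewrite odd_indexE/= -[in LHS]kE.
Qed.

#[local] Opaque ext_d.

Let term x (f : 'I_(n.*2.+1) -> 'rV[R]_(n.*2.+1)) : R :=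
  eta x (f ord0) *
  \prod_(i < n) ext_d S eta x (f (odd_index i)) (f (even_index i)).

Let odd0 i : (odd_index i == ord0) = false.
Proof. by rewrite -val_eqE /= odd_indexE. Qed.

Let even0 i : (even_index i == ord0) = false.
Proof. by rewrite -val_eqE /= even_indexE. Qed.

Let odd_even i j : (odd_index i == even_index j) = false.
Proof.
rewrite -val_eqE /= odd_indexE even_indexE.
by apply/negP => /eqP /(congr1 odd); rewrite /= !odd_double.
Qed.

Let odd_odd i j : (odd_index i == odd_index j) = (i == j).
Proof. by rewrite -val_eqE /= !odd_indexE !eqSS -!muln2 eqn_pmul2r. Qed.

Let even_even i j : (even_index i == even_index j) = (i == j).
Proof. by rewrite -val_eqE /= !even_indexE !eqSS -!muln2 eqn_pmul2r. Qed.

Let prod_except (h g : 'I_n -> R) i :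
  (forall j, j != i -> h j = g j) -> \prod_j h j = h i * \prod_(j | j != i) g j.
Proof. by move=> hg; rewrite (bigD1 i)//=; congr (_ * _); exact: eq_bigr. Qed.

Let mulr_rot (p q r : R) : p * (q * r) = p * r * q.
Proof. by rewrite mulrA mulrAC. Qed.

Let mulr_rotN (p q r : R) : p * (- q * r) = - (p * r) * q.
Proof. by rewrite mulNr mulrN mulNr mulr_rot. Qed.

Let mulr_affine (e k p q r : R) : p = k * q + r -> e * p = k * (e * q) + e * r.
Proof. by move=> ->; rewrite mulrDr mulrCA. Qed.

Let pairing x (f : 'I_(n.*2.+1) -> 'rV[R]_(n.*2.+1)) (i : 'I_n) : R :=
  ext_d S eta x (f (odd_index i)) (f (even_index i)).

Let pairing_update x f k z i : odd_index i != k -> even_index i != k ->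
  pairing x (update_at f k z) i = pairing x f i.
Proof. by rewrite /pairing /update_at => /negPf -> /negPf ->. Qed.

(** Seen as a function of one slot, a term is a multiple of [eta x z] or of [ext_d S eta x z w],
    where [w] sits in the partner slot and antisymmetry brings [z] to the left. This normal form
    gives both the linearity of the volume and its vanishing on a common kernel. *)
Let term_update x (f : 'I_(n.*2.+1) -> 'rV[R]_(n.*2.+1)) k : exists c : R,
  (forall z, term x (update_at f k z) = c * eta x z) \/
  exists w, forall z, term x (update_at f k z) = c * ext_d S eta x z w.
Proof.
have [->|[i ->]|[i ->]] := ordinal_doubleP k.
- exists (\prod_i pairing x f i); left=> z.
  have -> : term x (update_at f ord0 z) = eta x z * \prod_i pairing x f i.
    apply: (congr1 (fun t : R => eta x z * t)).
    by apply: eq_bigr => i _; apply: pairing_update; rewrite ?odd0 ?even0.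
  exact: mulrC.
- exists (eta x (f ord0) * \prod_(j | j != i) pairing x f j).
  right; exists (f (even_index i)) => z.
  have u0 : update_at f (odd_index i) z ord0 = f ord0.
    by rewrite /update_at eq_sym odd0.
  have E : \prod_j pairing x (update_at f (odd_index i) z) j =
      ext_d S eta x z (f (even_index i)) * \prod_(j | j != i) pairing x f j.
    apply: (etrans (@prod_except (pairing x (update_at f (odd_index i) z)) (pairing x f) i _)).
      by move=> j ji; apply: pairing_update; rewrite ?odd_odd// eq_sym odd_even.
    apply: (congr1 (fun t : R => t * _)).
    by rewrite /pairing /update_at eqxx [even_index i == _]eq_sym odd_even.
  have A : term x (update_at f (odd_index i) z) = eta x (f ord0) *
      \prod_j pairing x (update_at f (odd_index i) z) j.
    by apply: (congr1 (fun t : R => t * _)); rewrite u0.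
  exact: (etrans A (etrans (congr1 (fun t : R => eta x (f ord0) * t) E) (mulr_rot _ _ _))).
- exists (- (eta x (f ord0) * \prod_(j | j != i) pairing x f j)).
  right; exists (f (odd_index i)) => z.
  have u0 : update_at f (even_index i) z ord0 = f ord0.
    by rewrite /update_at eq_sym even0.
  have E : \prod_j pairing x (update_at f (even_index i) z) j =
      ext_d S eta x (f (odd_index i)) z * \prod_(j | j != i) pairing x f j.
    apply: (etrans (@prod_except (pairing x (update_at f (even_index i) z)) (pairing x f) i _)).
      by move=> j ji; apply: pairing_update; rewrite ?even_even// odd_even.
    apply: (congr1 (fun t : R => t * _)).
    by rewrite /pairing /update_at eqxx odd_even.
  have A : term x (update_at f (even_index i) z) = eta x (f ord0) *
      \prod_j pairing x (update_at f (even_index i) z) j.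
    by apply: (congr1 (fun t : R => t * _)); rewrite u0.
  apply: (etrans A (etrans (congr1 (fun t : R => eta x (f ord0) * t) E) _)).
  have C : ext_d S eta x (f (odd_index i)) z = - ext_d S eta x z (f (odd_index i)).
    exact: ext_dC.
  apply: (etrans (congr1 (fun t : R => eta x (f ord0) * (t * _)) C)).
  exact: mulr_rotN.
Qed.

Let contact_volumeE x v : contact_volume S eta x v =
  \sum_(s : 'S_(n.*2.+1)) (-1) ^+ s * term x (v \o s).
Proof.
apply: eq_bigr => s _; rewrite /term /odd_index /even_index -!lock.
by rewrite -mulrA.
Qed.

Let update_perm (s : 'S_(n.*2.+1)) (v : 'I_(n.*2.+1) -> 'rV[R]_(n.*2.+1)) j z :
  update_at v j z \o s = update_at (v \o s) ((s^-1)%g j) z.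
Proof.
apply/funext => k; rewrite /update_at /=.
by rewrite -(inj_eq (@perm_inj _ s)) permKV.
Qed.

Lemma contact_volume_linear x v j k u w :
  contact_volume S eta x (update_at v j (k *: u + w)) =
  k * contact_volume S eta x (update_at v j u) + contact_volume S eta x (update_at v j w).
Proof.
rewrite !contact_volumeE big_distrr/= -big_split/=; apply: eq_bigr => s _.
rewrite !update_perm; apply: mulr_affine.
have [c [E|[w' E]]] := term_update x (v \o s) ((s^-1)%g j).
  apply: (etrans (E _)); rewrite [eta x _]linearP/=.
  by rewrite (E u) (E w) mulrDr mulrCA.
apply: (etrans (E _)); rewrite ext_dDl// ext_dZl//.
by rewrite (E u) (E w) mulrDr mulrCA.
Qed.

(* The permutations s and s * tperm i j contribute opposite terms. *)
Lemma contact_volume_alternating x v i j :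
  i != j -> v i = v j -> contact_volume S eta x v = 0.
Proof.
move=> ij vij; pose t := tperm i j.
have oddMt (s : 'S_(n.*2.+1)) : (s * t)%g = ~~ s :> bool.
  by rewrite odd_permM odd_tperm ij addbT.
rewrite contact_volumeE (bigID (@odd_perm _)) /=.
apply: canLR (subrK _) _; rewrite add0r -sumrN.
rewrite (reindex_inj (mulIg t)); apply: eq_big => //= s; rewrite oddMt => /negPf ->.
rewrite expr0 mul1r expr1 mulN1r; apply: (congr1 (fun f => - term x f)).
apply/funext => k /=; rewrite permM /t.
by case: tpermP => // ->; rewrite vij.
Qed.

(** A vector killed by [eta] and by d eta annihilates every term of the volume, whatever slot it
    occupies, so the linear algebra of top-degree alternating forms applies. *)
Lemma contact_nondegenerate x z :
  (exists v, contact_volume S eta x v != 0) ->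
  eta x z = 0 -> (forall w, ext_d S eta x z w = 0) -> z = 0.
Proof.
move=> [v v0] z1 z2.
apply: (@alternating_nondegenerate _ _ (contact_volume S eta x) v z) => //.
- by move=> *; exact: contact_volume_linear.
- by move=> *; apply: contact_volume_alternating; eassumption.
- move=> j; rewrite contact_volumeE big1// => s _; rewrite update_perm.
  by have [c [E|[w' E]]] := term_update x (v \o s) ((s^-1)%g j);
    rewrite E ?z1 ?z2 !mulr0.
Qed.

End ContactNondegeneracy.

(** * One-parameter subgroups and infinitesimal generators *)

Section CurvesAndPairs.
Variable R : realType.
Implicit Types V W : normedModType R.

Lemma derive_pair V W W' (f : V -> W) (g : V -> W') (x u : V) :
  differentiable f x -> differentiable g x ->
  'D_u (fun y => (f y, g y)) x = ('D_u f x, 'D_u g x).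
Proof.
move=> df dg; rewrite deriveE ?diff_pair//=; last exact: differentiable_pair.
by rewrite !deriveE.
Qed.

Lemma derive_partial1 V V' W (F : V * V' -> W) (a u : V) (b : V') :
  differentiable F (a, b) -> 'D_(u, 0) F (a, b) = 'D_u (fun x => F (x, b)) a.
Proof.
move=> dF; have di := smooth_at_differentiable (smooth_at_id a).
have dc : differentiable (fun _ : V => b) a by exact: differentiable_cst.
have -> : (fun x => F (x, b)) = F \o (fun x => (x, b)) by [].
have dp := differentiable_pair di dc.
rewrite (derive_comp u dp dF).
by rewrite derive_pair// derive_cst derive_id.
Qed.

Lemma derive_partial2 V V' W (F : V * V' -> W) (a : V) (b u : V') :
  differentiable F (a, b) -> 'D_(0, u) F (a, b) = 'D_u (fun y => F (a, y)) b.
Proof.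
move=> dF; have di := smooth_at_differentiable (smooth_at_id b).
have dc : differentiable (fun _ : V' => a) b by exact: differentiable_cst.
have -> : (fun y => F (a, y)) = F \o (fun y => (a, y)) by [].
have dp := differentiable_pair dc di.
rewrite (derive_comp u dp dF).
by rewrite derive_pair// derive_cst derive_id.
Qed.

Lemma smooth_at_fst V V' (p : V * V') : smooth_at fst p.
Proof.
have lin : linear (fst : (V * V')%type -> V) by [].
pose l : {linear (V * V')%type -> V} := HB.pack (fst : (V * V')%type -> V)
  (GRing.isLinear.Build _ _ _ _ _ lin).
by apply: (@smooth_at_linear _ _ _ l) => z; exact: cvg_fst.
Qed.

Lemma smooth_at_snd V V' (p : V * V') : smooth_at snd p.
Proof.
have lin : linear (snd : (V * V')%type -> V') by [].
pose l : {linear (V * V')%type -> V'} := HB.pack (snd : (V * V')%type -> V')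
  (GRing.isLinear.Build _ _ _ _ _ lin).
by apply: (@smooth_at_linear _ _ _ l) => z; exact: cvg_snd.
Qed.

Lemma fin_dim_real : fin_dim R.
Proof.
exists unit, (fun _ => 1), (fun _ => (idfun : {linear R -> R^o})).
split=> [_ x|w]; first exact: cvg_id.
by rewrite big_const card_unit /= addr0 /GRing.scale/= mulr1.
Qed.

Lemma smooth_into_comp V V' n (T : topologicalType) (S : manifold_on R n T)
    (f : V -> V') (g : V' -> T) (v : V) : fin_dim V' ->
  smooth_at f v -> smooth_into S g (f v) -> smooth_into S (g \o f) v.
Proof.
move=> fd sf [cg sg]; split.
  by apply: continuous_comp; first exact: smooth_at_continuous.
by move=> q qv; exact: (smooth_at_comp fd sf (sg q qv)).
Qed.

Lemma smooth_map_intro n1 n2 (T1 T2 : topologicalType) (S1 : manifold_on R n1 T1)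
    (S2 : manifold_on R n2 T2) (f : T1 -> T2) :
  (forall p y, ccod (chart_at S1 p) y -> smooth_into S2 (f \o cinv (chart_at S1 p)) y) ->
  smooth_map S1 S2 f.
Proof.
move=> sf; split=> [x|p q]; last first.
  by apply: smooth_at_on => y [py qy]; have [_ /(_ q qy)] := sf p y py.
have xx := chart_at_dom S1 x.
have [c _] := sf x _ (cmap_cod xx).
have h : {for x, continuous ((f \o cinv (chart_at S1 x)) \o cmap (chart_at S1 x))}.
  by apply: continuous_comp => //; exact: cmap_continuous.
have E : \forall z \near x,
    ((f \o cinv (chart_at S1 x)) \o cmap (chart_at S1 x)) z = f z.
  have nU := open_nbhs_nbhs (conj (cdom_open (chart_at S1 x)) xx).
  apply: filterS nU => z zx.
  by rewrite /= cmapK.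
move: h; rewrite /prop_for /continuous_at (nbhs_singleton E).
by apply: cvg_trans; apply: near_eq_cvg.
Qed.

Lemma locally_constant_real (T : Type) (e : R -> T) :
  (forall t0, \forall t \near t0, e t = e t0) -> forall t, e t = e 0.
Proof.
move=> loc; have cR : connected [set: R].
  by apply/connected_intervalP.
pose B := [set t | e t = e 0].
have oB : open B.
  rewrite openE => t /= Bt; rewrite /interior; apply: filterS (loc t) => s.
  by rewrite /B/= => ->.
have oCB : open (~` B).
  rewrite openE => t /= Bt; rewrite /interior; apply: filterS (loc t) => s.
  by rewrite /B/= => ->.
have BT : B = setT.
  apply: cR.
  - by exists 0.
  - by exists B => //; rewrite setTI.
  - by exists B; rewrite ?setTI// -[B]setCK; exact: open_closedC.
by move=> t; have : B t by rewrite BT.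
Qed.

(** The mean value theorem in a chart gives local constancy, and connectedness of the line makes it
    global. *)
Lemma constant_of_derive0 n (T : topologicalType) (S : manifold_on R n T) (e : R -> T) :
  (forall t, smooth_into S e t) ->
  (forall t p, cdom (chart_at S p) (e t) -> 'D_1 (cmap (chart_at S p) \o e) t = 0) ->
  forall t, e t = e 0.
Proof.
move=> se de; apply: locally_constant_real => t0; pose p := e t0.
have pt : cdom (chart_at S p) (e t0) := chart_at_dom S _.
have n1 := near_in_open (se t0).1 (cdom_open (chart_at S p)) pt.
have [r /= r0 H] := (nbhs_ballP _ _).1 n1.
apply/nbhs_ballP; exists r => //= t; rewrite -ball_normE/= distrC => tr.
have inp s : `|s - t0| < r -> cdom (chart_at S p) (e s).
  by move=> sr; apply: H; rewrite -ball_normE/= distrC.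
have E := @derive_eq0_const R n (cmap (chart_at S p) \o e) t0 r _ t tr.
rewrite -(cmapK (inp t tr)) -[in RHS](cmapK pt); congr (cinv _ _); apply: E.
move=> s /inp ps; split; last exact: de.
by apply: smooth_at_differentiable; exact: (se s).2.
Qed.

End CurvesAndPairs.

Section OneParameterSubgroups.
Variables (R : realType) (d : nat) (G : lieGroup R d).
Notation SG := (lg_manifold G).
Notation mul := (@lg_mul R d G).
Notation inv := (@lg_inv R d G).
Notation one := (lg_one G).

Lemma lg_mulKg (g h : G) : mul (inv g) (mul g h) = h.
Proof. by rewrite lg_mulA lg_mulVg lg_mul1g. Qed.

Lemma lg_mulgV (g : G) : mul g (inv g) = one.
Proof.
by rewrite -(lg_mul1g (mul g (inv g))) -(lg_mulVg (inv g)) -lg_mulA (lg_mulKg g).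
Qed.

Lemma lg_mulg1 (g : G) : mul g one = g.
Proof. by rewrite -(lg_mulVg g) lg_mulA lg_mulgV lg_mul1g. Qed.

Lemma smooth_into_mul (V : normedModType R) (f g : V -> G) v :
  smooth_into SG f v -> smooth_into SG g v ->
  smooth_into SG (fun v' => mul (f v') (g v')) v.
Proof. by apply: smooth_map2_into; exact: lg_mul_smooth. Qed.

Lemma one_parameter0 xi (c : R -> G) : one_parameter_subgroup xi c -> c 0 = one.
Proof.
move=> [_ cD _]; have := cD 0 0; rewrite addr0 => /(congr1 (mul (inv (c 0)))).
by rewrite lg_mulKg lg_mulVg => ->.
Qed.

Lemma one_parameter_into xi (c : R -> G) : one_parameter_subgroup xi c ->
  forall t, smooth_into SG c t.
Proof. by move=> [sc _ _]; apply/smooth_curve_into. Qed.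

Let opp_diff (t : R) : differentiable (-%R : R -> R) t /\ 'D_1 (-%R : R -> R) t = -1.
Proof.
have h : smooth_at (-%R : R -> R) t.
  exact: (smooth_atN (smooth_at_id t)).
split; first exact: smooth_at_differentiable.
rewrite -[LHS]/('D_1 (- (id : R -> R)) t) deriveN; last exact: derivable_id.
by rewrite derive_id.
Qed.

(* t |-> c1 (- t) * c2 t has zero derivative, because at each t it is the image of
   (c1 (- s), c2 s), with velocity (- xi, xi) at s = 0, under a map K with
   K (h, 1) = K (1, h). No uniqueness theorem for ODEs is needed. *)
Lemma one_parameter_unique xi (c1 c2 : R -> G) :
  one_parameter_subgroup xi c1 -> one_parameter_subgroup xi c2 -> c1 =1 c2.
Proof.
move=> h1 h2; have [_ D1 v1] := h1; have [_ D2 v2] := h2.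
have z1 := one_parameter0 h1; have z2 := one_parameter0 h2.
have s1 := one_parameter_into h1; have s2 := one_parameter_into h2.
pose e t := mul (c1 (- t)) (c2 t).
have sm t : smooth_into SG (c1 \o -%R) t.
  apply: smooth_into_comp; first exact: fin_dim_real.
    exact: (smooth_atN (smooth_at_id t)).
  exact: s1.
have se t : smooth_into SG e t.
  exact: smooth_into_mul (sm t) (s2 t).
suff ec t : e t = one.
  move=> t; have := ec t; rewrite /e => /(congr1 (mul (c1 t))).
  by rewrite lg_mulA -D1 subrr z1 lg_mul1g lg_mulg1 => ->.
suff -> : e t = e 0 by rewrite /e oppr0 z1 z2 lg_mul1g.
move: t; apply: (constant_of_derive0 se) => t p pt.
pose o := chart_at SG one; pose psi := cinv o; pose phi := cmap o; pose e0 := phi one.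
have oo : cdom o one := chart_at_dom SG _.
have oe : ccod o e0 := cmap_cod oo.
have psi0 : psi e0 = one by exact: cmapK.
pose K (ab : 'rV[R]_d * 'rV[R]_d) :=
  mul (c1 (- t)) (mul (psi ab.1) (mul (psi ab.2) (c2 t))).
have sK : smooth_into SG K (e0, e0).
  apply: smooth_into_mul; first exact: smooth_into_cst.
  apply: smooth_into_mul.
    apply: (smooth_into_comp (fin_dim_rV R d) (smooth_at_fst _)).
    exact: smooth_into_cinv.
  apply: smooth_into_mul; last exact: smooth_into_cst.
  apply: (smooth_into_comp (fin_dim_rV R d) (smooth_at_snd _)).
  exact: smooth_into_cinv.
have K0 : K (e0, e0) = e t by rewrite /K /= psi0 !lg_mul1g.
have pK : cdom (chart_at SG p) (K (e0, e0)) by rewrite K0.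
have dK := smooth_at_differentiable (sK.2 _ pK).
pose gam (s : R) := (phi (c1 (- s)), phi (c2 s)).
have sphi1 : smooth_at (phi \o (c1 \o -%R)) 0.
  by apply: (sm 0).2; rewrite /= oppr0 z1.
have sphi2 : smooth_at (phi \o c2) 0 by apply: (s2 0).2; rewrite z2.
have E : \forall s \near (0 : R),
    (cmap (chart_at SG p) \o K) (gam s) = (cmap (chart_at SG p) \o e) (s + t).
  have n1 : \forall s \near (0 : R), cdom o (c1 (- s)).
    by apply: (near_in_open (sm 0).1 (cdom_open o)); rewrite /= oppr0 z1.
  have n2 : \forall s \near (0 : R), cdom o (c2 s).
    by apply: (near_in_open (s2 0).1 (cdom_open o)); rewrite z2.
  apply: filterS (filterI n1 n2) => s [p1 p2] /=; congr (cmap _ _).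
  rewrite /K /gam /= /psi /phi !cmapK// /e D2 opprD [- s + _]addrC D1.
  by rewrite !lg_mulA.
have g0 : gam 0 = (e0, e0) by rewrite /gam oppr0 z1 z2.
have Dphi1 : 'D_1 (phi \o (c1 \o -%R)) 0 = - xi.
  have [dop Dop] := opp_diff 0.
  have sp : smooth_at (phi \o c1) 0 by apply: (s1 0).2; rewrite z1.
  rewrite -[LHS]/('D_1 ((phi \o c1) \o -%R) 0) derive_comp//; last first.
    by rewrite oppr0; exact: smooth_at_differentiable.
  rewrite Dop oppr0 deriveN_dir; last exact: smooth_at_differentiable.
  by rewrite -v1 /velocity z1.
have Dphi2 : 'D_1 (phi \o c2) 0 = xi by rewrite -v2 /velocity z2.
(* Translating the parameter by [t] moves the derivative to 0, where [e (s + t)] is [K (gam s)] in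
   coordinates. *)
have -> : 'D_1 (cmap (chart_at SG p) \o e) t =
    'D_1 ((cmap (chart_at SG p) \o e) \o (fun s => s + t)) 0.
  have dt : differentiable (fun s : R => s + t) 0.
    by apply: (@differentiableD _ _ _ id (cst t)) => //; exact: differentiable_cst.
  have Dt : 'D_1 (fun s : R => s + t) 0 = 1.
    rewrite -[LHS]/('D_1 ((id : R -> R) + cst t) 0) deriveD//.
    by rewrite derive_id derive_cst addr0.
  rewrite derive_comp// ?add0r ?Dt//.
  by apply: smooth_at_differentiable; exact: (se t).2.
rewrite -(near_eq_derive _ E).
have dgam : differentiable gam 0.
  by apply: differentiable_pair; exact: smooth_at_differentiable.
have Dgam : 'D_1 gam 0 = (- xi, xi).
  rewrite -Dphi1 -Dphi2.
  exact: (derive_pair (1 : R) (smooth_at_differentiable sphi1) (smooth_at_differentiable sphi2)).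
rewrite -[LHS]/('D_1 ((cmap (chart_at SG p) \o K) \o gam) 0).
rewrite derive_comp//; last by rewrite g0.
rewrite Dgam g0.
have -> : (- xi, xi) = - (xi, 0) + (0, xi) :> ('rV[R]_d * 'rV[R]_d)%type.
  by congr (_, _); rewrite /= ?oppr0 ?addr0 ?add0r.
rewrite deriveD_dir// deriveN_dir// derive_partial1// derive_partial2//.
have -> : (fun x => (cmap (chart_at SG p) \o K) (x, e0)) =
          (fun x => (cmap (chart_at SG p) \o K) (e0, x)).
  by apply/funext => x; rewrite /= /K /= psi0 !lg_mul1g.
by rewrite addNr.
Qed.

End OneParameterSubgroups.

Section ExponentialMap.
Variables (R : realType) (d : nat) (G : lieGroup R d).
Notation SG := (lg_manifold G).
Notation mul := (@lg_mul R d G).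
Notation inv := (@lg_inv R d G).
Notation one := (lg_one G).

Lemma lg_invK (g : G) : inv (inv g) = g.
Proof. by rewrite -[LHS]lg_mulg1 -(lg_mulVg g) lg_mulKg. Qed.

Lemma one_parameter_intro xi (c : R -> G) : (forall t, smooth_into SG c t) ->
  (forall s t, c (s + t) = mul (c s) (c t)) -> tangent_map SG c 0 1 = xi ->
  one_parameter_subgroup xi c.
Proof. by move=> sc cD cv; split=> //; apply/smooth_curve_into. Qed.

Lemma one_parameter_tangent_map xi (c : R -> G) :
  one_parameter_subgroup xi c -> tangent_map SG c 0 1 = xi.
Proof. by case. Qed.

Lemma one_parameter_scale xi (c : R -> G) (k : R) :
  one_parameter_subgroup xi c ->
  one_parameter_subgroup (k *: xi) (fun t => c (k * t)).
Proof.
move=> hc; have sc := one_parameter_into hc; have c0 := one_parameter0 hc.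
have sk (t : R) : smooth_at (fun t : R => k * t) t.
  by apply: smooth_atM; [exact: smooth_at_cst | exact: smooth_at_id].
have Dk : 'D_1 (fun t : R => k * t) 0 = k.
  have -> : (fun t : R => k * t) = k \*: (id : R -> R) by [].
  by rewrite deriveZ ?derive_id /GRing.scale/= ?mulr1//; exact: derivable_id.
apply: one_parameter_intro.
- move=> t; apply: (smooth_into_comp (fin_dim_real R) (sk t)); exact: sc.
- by move=> s t; case: hc => _ cD _; rewrite mulrDr cD.
- rewrite -(one_parameter_tangent_map hc) /tangent_map mulr0.
  have sp := (sc 0).2 _ (chart_at_dom SG _).
  rewrite -[LHS]/('D_1 ((cmap (chart_at SG (c 0)) \o c) \o (fun t : R => k * t)) 0).
  rewrite derive_comp; last 2 first.
  + exact: smooth_at_differentiable.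
  + by rewrite mulr0; exact: smooth_at_differentiable.
  rewrite Dk mulr0 -deriveZ_dir; last exact: smooth_at_differentiable.
  by rewrite /GRing.scale/= mulr1.
Qed.

Lemma one_parameter_cst : one_parameter_subgroup 0 (fun _ : R => one).
Proof.
apply: one_parameter_intro => [t|s t|]; first exact: smooth_into_cst.
  by rewrite lg_mul1g.
exact: tangent_map_cst.
Qed.

(** The rescaled subgroup [s |-> c (t * s)] has velocity [t *: xi] and value [c t] at 1; by
    uniqueness the choice in [lie_exp] returns that value. *)
Lemma lie_expE xi (c : R -> G) (t : R) :
  one_parameter_subgroup xi c -> lie_exp G (t *: xi) = c t.
Proof.
move=> hc; rewrite /lie_exp.
have hct := one_parameter_scale t hc.
case: xgetP => [g _ [c' hc' <-]|h].
  by rewrite (one_parameter_unique hc' hct) mulr1.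
by exfalso; apply: (h (c t)); exists (fun s => c (t * s)); rewrite ?mulr1.
Qed.

(** A subgroup for a nonzero multiple of [xi] would rescale to one for [xi], so [xget] falls back on
    its default, the unit; at [t = 0] the constant subgroup gives the unit too. *)
Lemma lie_exp_default xi (t : R) :
  (forall c : R -> G, ~ one_parameter_subgroup xi c) -> lie_exp G (t *: xi) = one.
Proof.
move=> h; have [->|t0] := eqVneq t 0.
  rewrite scale0r; have := lie_expE 0 one_parameter_cst.
  by rewrite scaler0.
rewrite /lie_exp; case: xgetP => // g _ [c hc _].
exfalso; apply: (h (fun s => c (t^-1 * s))).
by have := one_parameter_scale t^-1 hc; rewrite scalerA mulVf// scale1r.
Qed.

Lemma smooth_map_conj (g : G) :
  smooth_map SG SG (fun h => mul (mul g h) (inv g)).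
Proof.
apply: smooth_map_intro => p y py; apply: smooth_into_mul.
  apply: smooth_into_mul; first exact: smooth_into_cst.
  exact: smooth_into_cinv.
exact: smooth_into_cst.
Qed.

Lemma one_parameter_conj xi (c : R -> G) (g : G) :
  one_parameter_subgroup xi c ->
  one_parameter_subgroup (Ad g xi) (fun t => mul (mul g (c t)) (inv g)).
Proof.
move=> hc; have sc := one_parameter_into hc; have c0 := one_parameter0 hc.
apply: one_parameter_intro.
- by move=> t; apply: (smooth_map_into (smooth_map_conj g)); exact: sc.
- move=> s t; case: hc => _ cD _; rewrite cD -!lg_mulA; congr (mul _ (mul _ _)).
  by rewrite lg_mulKg.
- have := mdiff_tangent_map (1 : R) (smooth_map_conj g) (sc 0).
  by rewrite (one_parameter_tangent_map hc) {1}c0 => <-.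
Qed.

End ExponentialMap.

(** * Infinitesimal generators, equivariance of the moment map and its differential *)

Section ActionCalculus.
Variables (R : realType) (d n : nat) (G : lieGroup R d) (T : topologicalType).
Variables (S : manifold_on R n T) (a : smooth_action G S).
Notation SG := (lg_manifold G).
Notation one := (lg_one G).

Lemma smooth_into_act (V : normedModType R) (f : V -> G) (g : V -> T) v :
  smooth_into SG f v -> smooth_into S g v ->
  smooth_into S (fun v' => act a (f v') (g v')) v.
Proof. by apply: smooth_map2_into; exact: act_smooth. Qed.

Lemma smooth_map_orbit (x : T) : smooth_map SG S ((act a) ^~ x).
Proof.
apply: smooth_map_intro => p y py; apply: smooth_into_act.
  exact: smooth_into_cinv.
exact: smooth_into_cst.
Qed.

Lemma smooth_map_act (g : G) : smooth_map S S (act a g).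
Proof.
apply: smooth_map_intro => p y py; apply: smooth_into_act.
  exact: smooth_into_cst.
exact: smooth_into_cinv.
Qed.

Lemma inf_generator_tangent_map xi (c : R -> G) (x : T) : one_parameter_subgroup xi c ->
  inf_generator a xi x = tangent_map S (fun t => act a (c t) x) 0 1.
Proof.
move=> hc; rewrite /inf_generator.
have -> // : (fun t : R => act a (lie_exp G (t *: xi)) x) = (fun t => act a (c t) x).
by apply/funext => t; rewrite (lie_expE t hc).
Qed.

Lemma inf_generator_mdiff xi (c : R -> G) (x : T) : one_parameter_subgroup xi c ->
  inf_generator a xi x = mdiff SG S ((act a) ^~ x) one xi.
Proof.
move=> hc; rewrite (inf_generator_tangent_map x hc).
have := mdiff_tangent_map (1 : R) (smooth_map_orbit x) (one_parameter_into hc 0).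
by rewrite (one_parameter_tangent_map hc) (one_parameter0 hc) => ->.
Qed.

Lemma inf_generator_default xi (x : T) :
  (forall c : R -> G, ~ one_parameter_subgroup xi c) -> inf_generator a xi x = 0.
Proof.
move=> h; rewrite /inf_generator.
have -> : (fun t : R => act a (lie_exp G (t *: xi)) x) = (fun _ => act a one x).
  by apply/funext => t; rewrite (lie_exp_default t h).
exact: tangent_map_cst.
Qed.

Section Complete.
(** In the reduction this is supplied by [exp_exists_of_regular]. *)
Hypothesis exp_exists : forall xi, exists c : R -> G, one_parameter_subgroup xi c.

(** Equivariance comes from exp(t xi) g = g (g^-1 exp(t xi) g), whose last factor is the
    one-parameter subgroup with velocity [Ad (lg_inv g) xi]. *)
Lemma inf_generator_act (g : G) xi (x : T) :
  inf_generator a xi (act a g x) =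
  mdiff S S (act a g) x (inf_generator a (Ad (lg_inv g) xi) x).
Proof.
have [c hc] := exp_exists xi; have hc' := one_parameter_conj (lg_inv g) hc.
rewrite (inf_generator_tangent_map _ hc) (inf_generator_tangent_map _ hc').
set c' := fun t : R => _ in hc' *.
have sc' : smooth_into S (fun t => act a (c' t) x) 0.
  by apply: smooth_into_act; [exact: one_parameter_into hc' 0|exact: smooth_into_cst].
have := mdiff_tangent_map (1 : R) (smooth_map_act g) sc'.
rewrite {1}(one_parameter0 hc') act1 => ->.
apply: (congr1 (fun f => tangent_map S f (0 : R) (1 : R))); apply/funext => t /=.
by rewrite -!actM /c' lg_invK !lg_mulA lg_mulgV lg_mul1g.
Qed.

Variable eta : T -> {scalar 'rV[R]_n}.
Hypothesis eta_inv : by_contactomorphisms a eta.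

Lemma moment_map_act (g : G) (x : T) xi :
  moment_map a eta (act a g x) xi = moment_map a eta x (Ad (lg_inv g) xi).
Proof. by rewrite /moment_map inf_generator_act eta_inv. Qed.

Lemma moment_level_act (mu : {scalar 'rV[R]_d}) (g : G) (x : T) :
  coadjoint g mu = mu -> moment_level a eta mu x -> moment_level a eta mu (act a g x).
Proof.
move=> gmu xmu; apply/funext => xi; rewrite moment_map_act.
by rewrite -[in RHS]gmu /coadjoint; congr (_ _); exact: xmu.
Qed.

Hypothesis smooth_eta : smooth_form S eta.

(* [A] is the action read in charts around the unit of G and around p. The pull-back
   of eta by A, evaluated on a vector tangent to M, does not depend on the
   coordinate along G; this stands for L_xi eta = 0, so that Cartan's formula is
   ext_d_pform applied to A. *)
Section FlowBox.
Variable p : T.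
Let psi := cinv (chart_at SG one).
Let e0 := cmap (chart_at SG one) one.
Let chi := cinv (chart_at S p).
Let A (q : 'rV[R]_d * 'rV[R]_n) : T := act a (psi q.1) (chi q.2).

Let one_cod : ccod (chart_at SG one) e0.
Proof. exact: cmap_cod (chart_at_dom SG one). Qed.

Let psi_e0 : psi e0 = one.
Proof. exact: cmapK (chart_at_dom SG one). Qed.

Let A_e0 y : A (e0, y) = chi y.
Proof. by rewrite /A /= psi_e0 act1. Qed.

Let smooth_A b y : ccod (chart_at SG one) b -> ccod (chart_at S p) y ->
  smooth_into S A (b, y).
Proof.
move=> hb hy; apply: smooth_into_act.
  apply: (smooth_into_comp (fin_dim_rV R d) (smooth_at_fst _)).
  exact: smooth_into_cinv.
apply: (smooth_into_comp (fin_dim_rV R n) (smooth_at_snd _)).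
exact: smooth_into_cinv.
Qed.

Let tangent_map_A1 y xi : ccod (chart_at S p) y ->
  tangent_map S A (e0, y) (xi, 0) = inf_generator a xi (chi y).
Proof.
move=> hy; have sA := smooth_A one_cod hy.
have [c hc] := exp_exists xi; rewrite (inf_generator_mdiff _ hc).
have dA := smooth_at_differentiable (sA.2 _ (chart_at_dom S _)).
have := mdiff_tangent_map xi (smooth_map_orbit (chi y)) (smooth_into_cinv one_cod).
rewrite -/psi tangent_map_cinv psi_e0 => ->.
by rewrite {1}/tangent_map derive_partial1.
Qed.

Let tangent_map_A2 b y v : ccod (chart_at SG one) b -> ccod (chart_at S p) y ->
  tangent_map S A (b, y) (0, v) = mdiff S S (act a (psi b)) (chi y) (tangent_map S chi y v).
Proof.
move=> hb hy; have sA := smooth_A hb hy.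
have dA := smooth_at_differentiable (sA.2 _ (chart_at_dom S _)).
rewrite (mdiff_tangent_map v (smooth_map_act (psi b)) (smooth_into_cinv hy)).
by rewrite {1}/tangent_map derive_partial2.
Qed.

Let pform_A1 y xi : ccod (chart_at S p) y ->
  pform S eta A (xi, 0) (e0, y) = - moment_map a eta (chi y) xi.
Proof. by move=> hy; rewrite /pform tangent_map_A1// A_e0 /moment_map opprK. Qed.

Let pform_A2 b y v : ccod (chart_at SG one) b -> ccod (chart_at S p) y ->
  pform S eta A (0, v) (b, y) = eta (chi y) (tangent_map S chi y v).
Proof. by move=> hb hy; rewrite /pform tangent_map_A2// eta_inv. Qed.

(** On the slice over the unit of G, the derivative of [A] along [(xi, 0)] is the generator, so J_xi
    is minus a pull-back of [eta] evaluated on a constant vector. *)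
Lemma smooth_at_moment xi y : ccod (chart_at S p) y ->
  smooth_at (((moment_map a eta) ^~ xi) \o cinv (chart_at S p)) y.
Proof.
move=> hy; have sp := smooth_at_pform smooth_eta (xi, 0) (smooth_A one_cod hy).
have si : smooth_at (fun z : 'rV[R]_n => (e0, z)) y.
  by apply: smooth_at_pair; [exact: smooth_at_cst|exact: smooth_at_id].
have h := smooth_atN (smooth_at_comp (fin_dim_prod (fin_dim_rV R d) (fin_dim_rV R n)) si sp).
have nU := open_nbhs_nbhs (conj (@ccod_open _ _ _ (chart_at S p)) hy).
by apply: smooth_at_eq h; apply: filterS nU => z pz; rewrite /= pform_A1// opprK.
Qed.

Lemma derive_moment xi y v : ccod (chart_at S p) y ->
  'D_v (((moment_map a eta) ^~ xi) \o cinv (chart_at S p)) y =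
  ext_d S eta (chi y) (inf_generator a xi (chi y)) (tangent_map S chi y v).
Proof.
move=> hy; have sA := smooth_A one_cod hy.
have := ext_d_pform smooth_eta (xi, 0) (0, v) sA.
have d1 := smooth_at_differentiable (smooth_at_pform smooth_eta (xi, 0) sA).
have d2 := smooth_at_differentiable (smooth_at_pform smooth_eta (0, v) sA).
rewrite (derive_partial1 xi d2) (derive_partial2 v d1).
have -> : 'D_xi (fun b => pform S eta A (0, v) (b, y)) e0 = 0.
  rewrite -(derive_cst (eta (chi y) (tangent_map S chi y v)) e0 xi).
  apply: near_eq_derive.
  have nU := open_nbhs_nbhs (conj (@ccod_open _ _ _ (chart_at SG one)) one_cod).
  by apply: filterS nU => b hb; exact: pform_A2.
have -> : 'D_v (fun z => pform S eta A (xi, 0) (e0, z)) y =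
   - 'D_v (((moment_map a eta) ^~ xi) \o cinv (chart_at S p)) y.
  rewrite -deriveN; last exact/diff_derivable/smooth_at_differentiable/smooth_at_moment.
  apply: near_eq_derive.
  have nU := open_nbhs_nbhs (conj (@ccod_open _ _ _ (chart_at S p)) hy).
  by apply: filterS nU => z hz; exact: pform_A1.
rewrite sub0r opprK => ->.
have E2 : tangent_map S A (e0, y) (0, v) = tangent_map S chi y v.
  rewrite {1}/tangent_map (derive_partial2 _ (smooth_at_differentiable (sA.2 _ (chart_at_dom S _)))).
  have E : (fun z => A (e0, z)) = chi by apply/funext => z; exact: A_e0.
  by rewrite -[LHS]/(tangent_map S (fun z => A (e0, z)) y v) E.
by apply: (f_equal3 (ext_d S eta)); [exact: A_e0 | exact: tangent_map_A1 | exact: E2].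
Qed.

End FlowBox.

Lemma smooth_fun_moment xi : smooth_fun S ((moment_map a eta) ^~ xi).
Proof. by move=> p; apply: smooth_at_on => y; exact: smooth_at_moment. Qed.

Lemma fdiff_moment xi x v :
  fdiff S ((moment_map a eta) ^~ xi) x v = ext_d S eta x (inf_generator a xi x) v.
Proof.
have xx := chart_at_dom S x.
rewrite /fdiff (derive_moment xi v (cmap_cod xx)) tangent_map_cinv.
by rewrite cmapK.
Qed.

End Complete.
End ActionCalculus.

(** * Descent along submersions, lifting along immersions *)

Section SubmersionsImmersions.
Variable R : realType.
Implicit Types V W : normedModType R.

(** The two tangent vectors agree in the chart at their common base point, and one transition map
    carries both to the chart [q]. *)
Lemma tangent_map_coord_eq V V' n (T : topologicalType) (S : manifold_on R n T)
    (g : V -> T) (h : V' -> T) v w v' w' q :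
  smooth_into S g v -> smooth_into S h v' -> g v = h v' ->
  cdom (chart_at S q) (g v) -> tangent_map S g v w = tangent_map S h v' w' ->
  'D_w (cmap (chart_at S q) \o g) v = 'D_w' (cmap (chart_at S q) \o h) v'.
Proof.
move=> sg sh gh qv; have xx := chart_at_dom S (g v).
have xh : cdom (chart_at S (g v)) (h v') by rewrite -gh.
have qh : cdom (chart_at S q) (h v') by rewrite -gh.
rewrite (derive_chart_change w sg xx qv) (derive_chart_change w' sh xh qh).
by rewrite /tangent_map -gh => ->.
Qed.

Lemma jacobianE n m (F : 'rV[R]_n -> 'rV[R]_m) y v : smooth_at F y ->
  'D_v F y = v *m jacobian F y.
Proof. by move=> sF; rewrite deriveEjacobian//; exact: smooth_at_differentiable. Qed.

Lemma row_full_onto n m (A : 'M[R]_(n, m)) :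
  (forall w : 'rV_m, exists v : 'rV_n, v *m A = w) -> row_full A.
Proof.
move=> onto; rewrite -sub1mx; apply/row_subP => i.
by have [v <-] := onto (row i 1%:M); exact: submxMl.
Qed.

Lemma row_free_injective n m (A : 'M[R]_(n, m)) :
  (forall v : 'rV_n, v *m A = 0 -> v = 0) -> row_free A.
Proof.
move=> inj; rewrite -kermx_eq0; apply/eqP/row_matrixP => i; rewrite row0.
by apply: inj; rewrite -row_mul mulmx_ker row0.
Qed.

(** The row space of [A] lies in the kernel of [D], and both have dimension [N - d]. *)
Lemma rank_exact k N d (A : 'M[R]_(k, N)) (D : 'M[R]_(N, d)) (v : 'rV[R]_N) :
  k = (N - d)%N -> row_free A -> row_full D -> A *m D = 0 -> v *m D = 0 ->
  exists u, u *m A = v.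
Proof.
move=> kE fA fD AD vD.
have sAk : (A <= kermx D)%MS by apply/sub_kermxP.
have rk : \rank (kermx D) = \rank A.
  by rewrite mxrank_ker (eqP fD) (eqP fA) kE.
have kA : (kermx D <= A)%MS.
  by have := mxrank_leqif_sup sAk => -[_]; rewrite rk eqxx => <-.
have vA : (v <= A)%MS by apply: submx_trans kA; apply/sub_kermxP.
by have [u uE] := submxP vA; exists u.
Qed.

Section Maps.
Variables (n1 n2 : nat) (T1 T2 : topologicalType).
Variables (S1 : manifold_on R n1 T1) (S2 : manifold_on R n2 T2) (f : T1 -> T2).

Lemma submersion_right_inverse p q y : submersion S1 S2 f ->
  ccod (chart_at S1 p) y -> cdom (chart_at S2 q) (f (cinv (chart_at S1 p) y)) ->
  let F := cmap (chart_at S2 q) \o f \o cinv (chart_at S1 p) in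
  exists B : 'M[R]_(n2, n1), B *m jacobian F y = 1%:M.
Proof.
move=> [sf onto] py qy F; have sF : smooth_at F y by exact: smooth_map_at.
exists (pinvmx (jacobian F y)); apply: mulVpmx; apply: row_full_onto => w.
pose x := cinv (chart_at S1 p) y.
have qz := cmap_cod qy.
(* Surjectivity is stated in the charts at [x] and [f x]: [w] is first converted from the chart [q],
   and [v'] below converts the preimage back to the chart [p]. *)
have [v vE] := onto x (tangent_map S2 (cinv (chart_at S2 q)) (cmap (chart_at S2 q) (f x)) w).
pose v' := 'D_v (cmap (chart_at S1 p) \o cinv (chart_at S1 x)) (cmap (chart_at S1 x) x).
exists v'; rewrite -jacobianE//.
have sp := smooth_into_cinv py.
have sq := smooth_into_cinv qz.
rewrite -[LHS]/('D_v' (cmap (chart_at S2 q) \o (f \o cinv (chart_at S1 p))) y).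
rewrite (@tangent_map_coord_eq _ _ _ _ S2 _ (cinv (chart_at S2 q)) _ _ (cmap (chart_at S2 q) (f x)) w)//.
- exact: derive_cmap_cinv.
- exact: (smooth_map_into sf sp).
- by rewrite cmapK.
- by rewrite -(mdiff_tangent_map v' sf sp) tangent_map_cinvK.
Qed.

Lemma immersion_left_inverse p q y : immersion S1 S2 f ->
  ccod (chart_at S1 p) y -> cdom (chart_at S2 q) (f (cinv (chart_at S1 p) y)) ->
  let F := cmap (chart_at S2 q) \o f \o cinv (chart_at S1 p) in
  exists B : 'M[R]_(n2, n1), jacobian F y *m B = 1%:M.
Proof.
move=> [sf inj] py qy F; have sF : smooth_at F y by exact: smooth_map_at.
exists (pinvmx (jacobian F y)); apply: mulmxVp; apply: row_free_injective => w.
rewrite -jacobianE// => wF.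
pose x := cinv (chart_at S1 p) y.
have sp := smooth_into_cinv py.
have t0 : tangent_map S1 (cinv (chart_at S1 p)) y w = 0.
  apply: (inj x); rewrite (mdiff_tangent_map w sf sp).
  have -> : mdiff S1 S2 f x 0 = 0 by exact: derive0.
  have sfp := smooth_map_into sf sp.
  have := derive_chart_change w sfp qy (chart_at_dom S2 _).
  by rewrite /tangent_map /= => ->; rewrite -[X in 'D_X _ _]/('D_w F y) wF derive0.
rewrite -(derive_cmap_cinv w py).
have c0 := smooth_into_cst S1 x y.
rewrite (@tangent_map_coord_eq _ _ _ _ S1 _ (fun _ => x) y w y w p sp c0)//.
- exact: derive_cst.
- exact: cinv_dom.
- by rewrite t0 tangent_map_cst.
Qed.

(* By induction on the order of differentiability: (D_v g) \o F is a combination with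
   smooth coefficients of derivatives of g \o F, F being the projection in charts. *)
Lemma smooth_fun_descend (h : T2 -> R) : submersion S1 S2 f ->
  (forall x, exists y, f y = x) -> smooth_fun S1 (h \o f) -> smooth_fun S2 h.
Proof.
move=> sub surj shf q k; have [sf _] := sub.
pose F y := cmap (chart_at S2 q) \o f \o cinv (chart_at S1 y).
pose c y := cmap (chart_at S1 y) y.
have cc y : ccod (chart_at S1 y) (c y) := cmap_cod (chart_at_dom S1 y).
have cK y : cinv (chart_at S1 y) (c y) = y := cmapK (chart_at_dom S1 y).
have sF y : cdom (chart_at S2 q) (f y) -> smooth_at (F y) (c y).
  by move=> qy; apply: smooth_map_at => //; rewrite cK.
have rinv y : cdom (chart_at S2 q) (f y) ->
    exists B : 'M[R]_(n2, n1), B *m jacobian (F y) (c y) = 1%:M.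
  by move=> qy; apply: submersion_right_inverse => //; rewrite cK.
have Fc y : F y (c y) = cmap (chart_at S2 q) (f y) by rewrite /F /= cK.
(* Surjectivity of [f] puts every point of the chart [q] in the image of some [F y] at its centre,
   where [descend_differentiable] applies. *)
have dg (g : 'rV[R]_n2 -> R) :
    (forall y, cdom (chart_at S2 q) (f y) -> smooth_at (g \o F y) (c y)) ->
    forall z, ccod (chart_at S2 q) z -> differentiable g z.
  move=> sg z qz; have [y yE] := surj (cinv (chart_at S2 q) z).
  have qy : cdom (chart_at S2 q) (f y) by rewrite yE; exact: cinv_dom.
  have zE : z = F y (c y) by rewrite Fc yE cinvK.
  have [B BJ] := rinv y qy.
  rewrite zE; apply: (@descend_differentiable _ _ _ _ _ B); first exact: sF.
    by move=> w; rewrite (jacobianE _ (sF y qy)) -mulmxA BJ mulmx1.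
  exact/smooth_at_differentiable/sg.
(* The induction ranges over all functions on the codomain of the chart, so that its hypothesis can
   be applied to ['D_v g]. *)
suff claim : forall g : 'rV[R]_n2 -> R,
    (forall y, cdom (chart_at S2 q) (f y) -> smooth_at (g \o F y) (c y)) ->
    Ck_on k (ccod (chart_at S2 q)) g.
  apply: claim => y qy.
  have s0 : smooth_at ((h \o f) \o cinv (chart_at S1 y)) (c y).
    by apply: (smooth_on_at _ (shf y)) => //; exact: ccod_open.
  apply: smooth_at_eq s0.
  have cfp : {for c y, continuous (f \o cinv (chart_at S1 y))}.
    by apply: continuous_comp; [exact: cinv_continuous | exact: sf.1].
  have pq : cdom (chart_at S2 q) ((f \o cinv (chart_at S1 y)) (c y)) by rewrite /= cK.
  by apply: filterS (near_eq_cinv_cmap cfp pq) => y' /= E; rewrite /F /= E.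
elim: k => [|k IH] g sg.
  by move=> z qz; apply: differentiable_continuous; exact: dg qz.
split=> [z qz|v]; first exact: dg qz.
apply: IH => y qy; have [B BJ] := rinv y qy; have sFy := sF y qy.
(* [B] is a right inverse of the Jacobian at the centre only. [M] stays invertible nearby, and [u]
   below, namely v M^-1 B, is a smooth lift through [F y] of the constant direction [v]. *)
pose M y' := B *m jacobian (F y) y'.
have M1 : M (c y) = 1%:M by rewrite /M BJ.
have sM : forall i j, smooth_at (fun y' => M y' i j) (c y).
  apply: smooth_at_mulmx => i j; first exact: smooth_at_cst.
  exact: smooth_at_jacobian.
have Mu : M (c y) \in unitmx by rewrite M1 unitmx1.
have [nM sMi] := smooth_at_invmx Mu sM.
pose u y' := v *m invmx (M y') *m B.
have su j : smooth_at (fun y' => u y' 0 j) (c y).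
  apply: smooth_at_mulmx => i l; last exact: smooth_at_cst.
  by apply: smooth_at_mulmx => i' l'; [exact: smooth_at_cst | exact: sMi].
have h1 : smooth_at (fun y' => \sum_j u y' 0 j *: 'D_(delta_mx 0 j) (g \o F y) y') (c y).
  apply: smooth_at_sum => j; apply: smooth_atZ; first exact: su.
  exact: smooth_at_derive (sg y qy).
apply: smooth_at_eq h1.
have m1 := near_smooth_at sFy.
have m2 := near_in_open (smooth_at_continuous sFy) (@ccod_open _ _ _ (chart_at S2 q)).
have m3 : \forall y' \near c y, ccod (chart_at S2 q) (F y y').
  by apply: m2; rewrite Fc; exact: cmap_cod.
apply: filterS (filterI (filterI m1 m3) nM) => y' [[sFy' qF] uM].
have dgF : differentiable g (F y y') := dg g sg _ qF.
have dF : differentiable (F y) y' := smooth_at_differentiable sFy'.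
rewrite -derive_sum_dir; last exact: differentiable_comp.
rewrite -row_sum_delta derive_comp// jacobianE// /u.
by rewrite -mulmxA mulmxKV.
Qed.

(** In charts Y J = X o F, with J the Jacobian of [f]. Multiplying by a matrix [B] that inverts J on
    one side at a single point, then by the inverse of J B, which exists nearby, expresses Y by
    smooth functions. *)
Lemma smooth_vfield_lift (X : T2 -> 'rV[R]_n2) (Y : T1 -> 'rV[R]_n1) :
  immersion S1 S2 f -> smooth_vfield S2 X ->
  (forall y, mdiff S1 S2 f y (Y y) = X (f y)) -> smooth_vfield S1 Y.
Proof.
move=> imm sX XY p; apply: smooth_at_on => y py; have [sf _] := imm.
pose q := f (cinv (chart_at S1 p) y).
have qy : cdom (chart_at S2 q) (f (cinv (chart_at S1 p) y)) := chart_at_dom S2 _.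
pose F := cmap (chart_at S2 q) \o f \o cinv (chart_at S1 p).
have sF : smooth_at F y by exact: smooth_map_at.
have [B JB] := immersion_left_inverse imm py qy.
pose M y' := jacobian F y' *m B.
have sM : forall i j, smooth_at (fun y' => M y' i j) y.
  apply: smooth_at_mulmx => i j; last exact: smooth_at_cst.
  exact: smooth_at_jacobian.
have Mu : M y \in unitmx by rewrite /M JB unitmx1.
have [nM sMi] := smooth_at_invmx Mu sM.
have sXF : smooth_at (vfield_in S2 X q \o F) y.
  apply: (smooth_at_comp (fin_dim_rV R n2) sF).
  apply: (smooth_on_at _ (sX q)); first exact: ccod_open.
  exact: cmap_cod.
have h1 : smooth_at (fun y' => (vfield_in S2 X q (F y') *m B) *m invmx (M y')) y.
  apply: smooth_at_rV => j; apply: smooth_at_mulmx => // i l.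
  apply: smooth_at_mulmx => i' l'; last exact: smooth_at_cst.
  by rewrite ord1; exact: smooth_at_coord.
apply: smooth_at_eq h1.
have cfp : {for y, continuous (f \o cinv (chart_at S1 p))}.
  by apply: continuous_comp; [exact: cinv_continuous | exact: sf.1].
have m1 := near_in_open cfp (cdom_open (chart_at S2 q)) qy.
have m2 := open_nbhs_nbhs (conj (@ccod_open _ _ _ (chart_at S1 p)) py).
apply: filterS (filterI (filterI m1 m2) (filterI nM (near_smooth_at sF))).
move=> y' [[qy' py'] [uM sF']].
have sp := smooth_into_cinv py'.
have zq : ccod (chart_at S2 q) (F y') by exact: cmap_cod.
have E : 'D_(vfield_in S1 Y p y') F y' = vfield_in S2 X q (F y').
  rewrite -[LHS]/('D_(vfield_in S1 Y p y') (cmap (chart_at S2 q) \o (f \o cinv (chart_at S1 p))) y').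
  rewrite (@tangent_map_coord_eq _ _ _ _ S2 _ (cinv (chart_at S2 q)) _ _ (F y') (vfield_in S2 X q (F y')))//.
  - exact: derive_cmap_cinv.
  - exact: (smooth_map_into sf sp).
  - exact: smooth_into_cinv.
  - by rewrite /F /= cmapK.
  - rewrite -(mdiff_tangent_map _ sf sp) (tangent_map_cinvK _ py') XY (tangent_map_cinvK _ zq).
    by rewrite /F /= cmapK.
rewrite -E (jacobianE _ sF') -(mulmxA _ _ B); exact: (mulmxK uM).
Qed.

End Maps.
End SubmersionsImmersions.

(** * Reduction *)

Section PullBack.
Variables (R : realType) (n1 n2 : nat) (T1 T2 : topologicalType).
Variables (S1 : manifold_on R n1 T1) (S2 : manifold_on R n2 T2) (f : T1 -> T2).
Hypothesis smooth_f : smooth_map S1 S2 f.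
Notation psi x := (cinv (chart_at S1 x)).
Notation base x := (cmap (chart_at S1 x) x).

Lemma mdiffE x v : mdiff S1 S2 f x v = tangent_map S2 (f \o psi x) (base x) v.
Proof. by rewrite /tangent_map /= (cmapK (chart_at_dom S1 x)). Qed.

Let smooth_into_base x : smooth_into S2 (f \o psi x) (base x).
Proof.
apply: (smooth_map_into smooth_f); apply: smooth_into_cinv.
exact: cmap_cod (chart_at_dom S1 x).
Qed.

Lemma fdiff_mdiff (h : T2 -> R) x v : smooth_fun S2 h ->
  fdiff S2 h (f x) (mdiff S1 S2 f x v) = 'D_v (h \o (f \o psi x)) (base x).
Proof.
move=> sh; have := fdiff_tangent_map v sh (smooth_into_base x).
by rewrite -mdiffE /= (cmapK (chart_at_dom S1 x)).
Qed.

Lemma ext_d_mdiff (eta : T2 -> {scalar 'rV[R]_n2}) x u v : smooth_form S2 eta ->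
  ext_d S2 eta (f x) (mdiff S1 S2 f x u) (mdiff S1 S2 f x v) =
  'D_u (pform S2 eta (f \o psi x) v) (base x) -
  'D_v (pform S2 eta (f \o psi x) u) (base x).
Proof.
move=> se; apply: esym; apply: (etrans (ext_d_pform se u v (smooth_into_base x))).
by rewrite -(mdiffE x u) -(mdiffE x v) /= (cmapK (chart_at_dom S1 x)).
Qed.

End PullBack.

Section HamiltonianFields.
Variables (R : realType) (n : nat) (T : topologicalType).
Variables (S : manifold_on R n.*2.+1 T) (eta : T -> {scalar 'rV[R]_(n.*2.+1)}).
Variable H : T -> R.

(** Evaluating the defining equation on the Reeb vector kills the d eta term and gives eta(X) = - H;
    substituting this back cancels H in the equation for d eta. *)
Lemma hamiltonian_fieldE (Rb X : T -> 'rV[R]_(n.*2.+1)) x :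
  reeb_field S eta Rb ->
  (forall v, ext_d S eta x (X x) v + eta x (X x) * eta x v
      = fdiff S H x v - (fdiff S H x (Rb x) + H x) * eta x v) ->
  eta x (X x) = - H x /\
  forall v, ext_d S eta x (X x) v = fdiff S H x v - fdiff S H x (Rb x) * eta x v.
Proof.
move=> [_ Rb1 Rb0] XE.
have EX : eta x (X x) = - H x.
  have := XE (Rb x); rewrite ext_dC Rb0 Rb1 oppr0 add0r !mulr1 => ->.
  by rewrite opprD addrA subrr add0r.
split=> // v; have := XE v; rewrite EX => /(canRL (addrK _)) ->.
by rewrite mulrDl mulNr opprK opprD addrA subrK.
Qed.

End HamiltonianFields.

Section Reduction.
Variables (R : realType) (n : nat) (M : topologicalType).
Variables (SM : manifold_on R n.*2.+1 M) (eta : M -> {scalar 'rV[R]_(n.*2.+1)}).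
Variables (H : M -> R) (d : nat) (G : lieGroup R d) (a : smooth_action G SM).
Hypothesis smooth_eta : smooth_form SM eta.
Hypothesis smooth_H : smooth_fun SM H.
Hypothesis a_contact : by_contactomorphisms a eta.
Hypothesis H_inv : forall g x, H (act a g x) = H x.
Variable mu : {scalar 'rV[R]_d}.
Hypothesis mu_regular : regular_value SM (moment_map a eta) mu.
Hypothesis mu_fixed : forall g : G, coadjoint g mu = mu.
Notation N := (moment_level a eta mu).
Notation Q := (reduced_space a eta mu).
Notation pi := (reduced_proj a eta mu).
Variables (SN : manifold_on R (n.*2.+1 - d) N) (SN_sub : immersion SN SM set_val).
Variables (m : nat) (SQ : manifold_on R m.*2.+1 Q).
Hypothesis SQ_quotient : submersion SN SQ pi.
Variable eta_mu : Q -> {scalar 'rV[R]_(m.*2.+1)}.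
Hypothesis eta_mu_contact : contact_form SQ eta_mu.
Hypothesis eta_mu_pullback : forall y v,
  eta_mu (pi y) (mdiff SN SQ pi y v) = eta (set_val y) (mdiff SN SM set_val y v).

Let smooth_iota : smooth_map SN SM set_val. Proof. by case: SN_sub. Qed.
Let smooth_pi : smooth_map SN SQ pi. Proof. by case: SQ_quotient. Qed.

Lemma levelP (y : N) : moment_map a eta (set_val y) = mu.
Proof. by case: y => x xN; rewrite set_valE /=; exact: (set_mem xN). Qed.

Lemma reduced_proj_surj (q : Q) : exists y, pi y = q.
Proof. by exists (repr q); exact: reprK. Qed.

Lemma reduced_proj_act (y y' : N) (g : G) :
  act a g (set_val y) = set_val y' -> pi y = pi y'.
Proof. by move=> gy; apply/eqquotP/asboolP; exists g. Qed.

Lemma reduced_proj_orbit (y y' : N) :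
  pi y = pi y' -> exists g, act a g (set_val y) = set_val y'.
Proof. by move=> /eqquotP/asboolP. Qed.

Definition reduced_hamiltonian (q : Q) : R := H (set_val (repr q : N)).

Lemma reduced_hamiltonianE (y : N) : reduced_hamiltonian (pi y) = H (set_val y).
Proof.
have [g gE] : exists g, act a g (set_val y) = set_val (repr (pi y) : N).
  by apply: reduced_proj_orbit; exact/esym/reprK.
by rewrite /reduced_hamiltonian -gE H_inv.
Qed.

Lemma smooth_reduced_hamiltonian : smooth_fun SQ reduced_hamiltonian.
Proof.
apply: (smooth_fun_descend SQ_quotient reduced_proj_surj).
have -> : reduced_hamiltonian \o pi = H \o set_val.
  by apply/funext => y; exact: reduced_hamiltonianE.
move=> p; apply: smooth_at_on => y py.
exact: (smooth_fun_comp smooth_H (smooth_map_into smooth_iota (smooth_into_cinv py))).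
Qed.

(** The standard pairing, identifying row vectors with covectors; it produces the covectors to which
    [mu_regular] is applied. *)
Definition scalar_of (w : 'rV[R]_d) : 'rV[R]_d -> R := fun xi => \sum_j xi 0 j * w 0 j.

Lemma scalar_of_is_linear w : linear_for *%R (scalar_of w).
Proof.
move=> k u v; rewrite /scalar_of big_distrr -big_split/=.
by apply: eq_bigr => j _; rewrite !mxE mulrDl mulrA.
Qed.

Definition scalar_form (w : 'rV[R]_d) : {scalar 'rV[R]_d} :=
  HB.pack (scalar_of w) (GRing.isLinear.Build R _ R *%R (scalar_of w) (scalar_of_is_linear w)).

(* If no one-parameter subgroup has velocity xi, then lie_exp is constant on the
   line of xi, so J is identically 0 at xi, and regularity of mu forces xi = 0. *)
Lemma exp_exists_of_regular (y : N) xi : exists c : R -> G, one_parameter_subgroup xi c.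
Proof.
apply: contrapT => /forallNP hc.
suff xi0 : xi = 0 by apply: (hc (fun _ => lg_one G)); rewrite xi0; exact: one_parameter_cst.
apply/rowP => i; rewrite mxE.
(* The covector chosen is the i-th coordinate, so its value at [xi] is the entry to be shown
   zero. *)
have [v /(_ xi)] := mu_regular (levelP y) (scalar_form (delta_mx 0 i)).
have -> : fdiff SM ((moment_map a eta) ^~ xi) (set_val y) v = 0.
  rewrite /fdiff.
  have -> : ((moment_map a eta) ^~ xi) \o cinv (chart_at SM (set_val y)) = fun _ => 0.
    by apply/funext => z; rewrite /= /moment_map (inf_generator_default a _ hc) linear0 oppr0.
  exact: derive_cst.
move=> h0; apply/esym; apply: (etrans h0).
rewrite /scalar_form /= /scalar_of (bigD1 i)//= big1 => [|j ji].
  by rewrite mxE !eqxx mulr1 addr0.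
by rewrite mxE (negPf ji) andbF mulr0.
Qed.

(** The orbit curve [c t] applied to [y] stays in the level because [mu] is fixed by the coadjoint
    action. Its velocity, taken in the level, goes to the generator under the inclusion and to 0
    under [pi], which is constant on orbits. The point to prove is that the curve is differentiable
    in the charts of the level. *)
Lemma vertical_vector (y : N) xi : exists u,
  mdiff SN SM set_val y u = inf_generator a xi (set_val y) /\ mdiff SN SQ pi y u = 0.
Proof.
have ex := exp_exists_of_regular y.
have [c hc] := ex xi; have c0 := one_parameter0 hc.
have inN t : act a (c t) (set_val y) \in N.
  apply/mem_set; apply: (moment_level_act ex a_contact) => //.
  exact: levelP.
pose gam (t : R) : N := exist _ (act a (c t) (set_val y)) (inN t).
have vgam t : set_val (gam t) = act a (c t) (set_val y) by [].
have gam0 : gam 0 = y by apply: val_inj; rewrite /= c0 act1.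
have sv t : smooth_into SM (set_val \o gam) t.
  apply: smooth_into_act; first exact: one_parameter_into hc t.
  exact: smooth_into_cst.
(* The level carries the subspace topology, so continuity can be tested in M. *)
have cgam : continuous gam.
  by apply: continuous_comp_initial => t; exact: (sv t).1.
have xx := chart_at_dom SM (set_val y); have yy := chart_at_dom SN y.
pose phi := cmap (chart_at SN y).
pose F := (cmap (chart_at SM (set_val y)) \o set_val) \o cinv (chart_at SN y).
have yc : ccod (chart_at SN y) (phi y) := cmap_cod yy.
have xd : cdom (chart_at SM (set_val y)) (set_val (cinv (chart_at SN y) (phi y))).
  by rewrite cmapK.
have sF : smooth_at F (phi y) by exact: smooth_map_at.
have [B JB] := immersion_left_inverse SN_sub yc xd.
have c0g : {for 0, continuous gam} := cgam 0.
have y0 : cdom (chart_at SN y) (gam 0) by rewrite gam0.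
have nE := near_eq_cinv_cmap c0g y0.
have dcurve : differentiable (cmap (chart_at SM (set_val y)) \o (set_val \o gam)) 0.
  by apply: smooth_at_differentiable; apply: (sv 0).2; rewrite /= gam0.
have dFg : differentiable (F \o (phi \o gam)) 0.
  apply: near_eq_differentiable dcurve.
  by apply: filterS nE => t; rewrite /F /phi /= => ->.
(* The one-sided inverse [B] from the immersion lifts the differentiability of the curve in M to its
   coordinates in the level. *)
have dg : differentiable (phi \o gam) 0.
  apply: (@lift_differentiable _ _ _ _ F B) => //=.
  - by rewrite gam0; exact: smooth_at_differentiable.
  - by move=> v; rewrite gam0 (jacobianE _ sF) -mulmxA JB mulmx1.
  - apply: continuous_comp; first exact: cgam.
    exact: cmap_continuous.
have dF : differentiable F ((phi \o gam) 0).
  by rewrite /= gam0; exact: smooth_at_differentiable.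
exists ('D_1 (phi \o gam) 0); split.
  have -> : mdiff SN SM set_val y ('D_1 (phi \o gam) 0) = 'D_('D_1 (phi \o gam) 0) F ((phi \o gam) 0).
    by rewrite /mdiff /= gam0.
  rewrite -(derive_comp (1 : R) dg dF) (inf_generator_tangent_map _ _ hc) /tangent_map.
  rewrite c0 act1; apply: near_eq_derive.
  by apply: filterS nE => t; rewrite /F /phi /= => ->.
pose P := (cmap (chart_at SQ (pi y)) \o pi) \o cinv (chart_at SN y).
have qd : cdom (chart_at SQ (pi y)) (pi (cinv (chart_at SN y) (phi y))).
  by rewrite cmapK//; exact: chart_at_dom.
have dP : differentiable P ((phi \o gam) 0).
  by rewrite /= gam0; apply/smooth_at_differentiable/smooth_map_at.
have -> : mdiff SN SQ pi y ('D_1 (phi \o gam) 0) = 'D_('D_1 (phi \o gam) 0) P ((phi \o gam) 0).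
  by rewrite /mdiff /= gam0.
rewrite -(derive_comp (1 : R) dg dP).
rewrite -(derive_cst (cmap (chart_at SQ (pi y)) (pi y)) (0 : R) (1 : R)).
apply: near_eq_derive; apply: filterS nE => t; rewrite /P /phi /= => ->.
by congr (cmap _ _); apply/esym; apply: (@reduced_proj_act _ _ (c t)).
Qed.

(* This says mu = 0 as soon as the level is not empty. It comes from eta_mu alone:
   iota^* eta = pi^* eta_mu vanishes on the vectors tangent to the orbits. *)
Lemma eta_inf_generator (y : N) xi :
  eta (set_val y) (inf_generator a xi (set_val y)) = 0.
Proof.
have [u [<- u0]] := vertical_vector y xi.
by rewrite -eta_mu_pullback u0 linear0.
Qed.

(** The Jacobian of the inclusion has full rank [n.*2.+1 - d], the matrix of dJ has rank [d] by
    regularity, and their product vanishes because J is constant on the level; [rank_exact]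
    identifies the image with the kernel. *)
Lemma level_tangent (y : N) (v : 'rV[R]_(n.*2.+1)) :
  (forall xi, fdiff SM ((moment_map a eta) ^~ xi) (set_val y) v = 0) ->
  exists u, mdiff SN SM set_val y u = v.
Proof.
move=> v0; have ex := exp_exists_of_regular y.
have sJ xi := smooth_fun_moment a ex smooth_eta xi.
have xx := chart_at_dom SM (set_val y); have yy := chart_at_dom SN y.
pose phi := cmap (chart_at SN y).
pose F := (cmap (chart_at SM (set_val y)) \o set_val) \o cinv (chart_at SN y).
have yc : ccod (chart_at SN y) (phi y) := cmap_cod yy.
have xd : cdom (chart_at SM (set_val y)) (set_val (cinv (chart_at SN y) (phi y))).
  by rewrite cmapK.
have sF : smooth_at F (phi y) by exact: smooth_map_at.
have [B JB] := immersion_left_inverse SN_sub yc xd.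
pose J xi := ((moment_map a eta) ^~ xi) \o cinv (chart_at SM (set_val y)).
pose x0 := cmap (chart_at SM (set_val y)) (set_val y).
have dJ xi : differentiable (J xi) x0.
  apply/smooth_at_differentiable; apply: (smooth_on_at _ (sJ xi (set_val y))).
    exact: ccod_open.
  exact: cmap_cod.
(* Linearity of the moment map in xi is not recorded in its type, so [D] collects the differentials
   of J along the basis vectors of the Lie algebra. *)
pose D := \matrix_(i < n.*2.+1, j < d) 'D_(delta_mx 0 i) (J (delta_mx 0 j)) x0.
have DE w j : (w *m D) 0 j = fdiff SM ((moment_map a eta) ^~ (delta_mx 0 j)) (set_val y) w.
  rewrite /fdiff -/(J _) -/x0 {2}(row_sum_delta w) derive_sum_dir// mxE.
  by apply: eq_bigr => i _; rewrite mxE.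
have FE w : w *m jacobian F (phi y) = mdiff SN SM set_val y w.
  by rewrite -(jacobianE _ sF).
have [||||u uE] := @rank_exact _ _ _ _ (jacobian F (phi y)) D v erefl.
- apply: row_free_injective => w w0.
  by rewrite -[w]mulmx1 -JB mulmxA w0 mul0mx.
- apply: row_full_onto => w.
  have [u uE] := mu_regular (levelP y) (scalar_form w).
  exists u; apply/rowP => j; rewrite DE uE /= /scalar_of (bigD1 j)//= big1 => [|i ij].
    by rewrite mxE !eqxx mul1r addr0.
  by rewrite mxE (negPf ij) andbF mul0r.
- apply/row_matrixP => i; rewrite row_mul row0; apply/rowP => j.
  rewrite DE mxE rowE FE; apply: (etrans (fdiff_mdiff smooth_iota _ _ (sJ _))).
  have -> : ((moment_map a eta) ^~ (delta_mx 0 j) \o (set_val \o cinv (chart_at SN y))) =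
      fun _ => mu (delta_mx 0 j).
    by apply/funext => z; rewrite /= levelP.
  exact: derive_cst.
- by apply/rowP => j; rewrite DE v0 mxE.
- by exists u; rewrite -FE.
Qed.

Lemma fdiff_inf_generator (y : N) xi : fdiff SM H (set_val y) (inf_generator a xi (set_val y)) = 0.
Proof.
have [c hc] := exp_exists_of_regular y xi; have c0 := one_parameter0 hc.
have sc : smooth_into SM (fun t => act a (c t) (set_val y)) 0.
  by apply: smooth_into_act; [exact: one_parameter_into hc 0|exact: smooth_into_cst].
have := fdiff_tangent_map (1 : R) smooth_H sc.
rewrite -(inf_generator_tangent_map _ _ hc) c0 act1 => ->.
have -> : H \o (fun t => act a (c t) (set_val y)) = fun _ => H (set_val y).
  by apply/funext => t; exact: H_inv.
exact: derive_cst.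
Qed.

(* In general d J_xi (X_H) = R(H) * mu xi up to sign, so that mu = 0 is essential. *)
Lemma hamiltonian_field_tangent (X : M -> 'rV[R]_(n.*2.+1)) (y : N) :
  hamiltonian_field SM eta H X -> exists u, mdiff SN SM set_val y u = X (set_val y).
Proof.
move=> [_ [Rb RbP XE]]; apply: level_tangent => xi.
have ex := exp_exists_of_regular y.
rewrite (fdiff_moment ex a_contact smooth_eta) ext_dC.
have [_ ->] := hamiltonian_fieldE RbP (XE (set_val y)).
by rewrite fdiff_inf_generator eta_inf_generator mulr0 subrr oppr0.
Qed.

(** The pull-backs of [eta_mu] by [pi] and of [eta] by the inclusion agree at all points near the
    centre of the chart, so their derivatives agree as well, and these compute both exterior
    derivatives. *)
Lemma ext_d_reduced (y : N) u v :
  ext_d SQ eta_mu (pi y) (mdiff SN SQ pi y u) (mdiff SN SQ pi y v) =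
  ext_d SM eta (set_val y) (mdiff SN SM set_val y u) (mdiff SN SM set_val y v).
Proof.
have yc := cmap_cod (chart_at_dom SN y).
have sp := smooth_into_cinv yc.
have E w : \forall z \near cmap (chart_at SN y) y,
    pform SQ eta_mu (pi \o cinv (chart_at SN y)) w z =
    pform SM eta (set_val \o cinv (chart_at SN y)) w z.
  have nU := open_nbhs_nbhs (conj (@ccod_open _ _ _ (chart_at SN y)) yc).
  apply: filterS nU => z zc; have sz := smooth_into_cinv zc.
  rewrite /pform -(mdiff_tangent_map _ smooth_pi sz) -(mdiff_tangent_map _ smooth_iota sz).
  exact: eta_mu_pullback.
rewrite (ext_d_mdiff smooth_pi _ _ _ eta_mu_contact.1).
rewrite (ext_d_mdiff smooth_iota _ _ _ smooth_eta).
by rewrite (near_eq_derive u (E v)) (near_eq_derive v (E u)).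
Qed.

Lemma fdiff_reduced (y : N) v :
  fdiff SQ reduced_hamiltonian (pi y) (mdiff SN SQ pi y v) =
  fdiff SM H (set_val y) (mdiff SN SM set_val y v).
Proof.
rewrite (fdiff_mdiff smooth_pi _ _ smooth_reduced_hamiltonian).
rewrite (fdiff_mdiff smooth_iota _ _ smooth_H).
have -> // : reduced_hamiltonian \o (pi \o cinv (chart_at SN y)) =
         H \o (set_val \o cinv (chart_at SN y)).
by apply/funext => z; exact: reduced_hamiltonianE.
Qed.

(* W = T pi (u) satisfies the equation of X_mu with R(H) in place of R_mu(H_mu);
   evaluating the difference on R_mu shows that these two numbers are equal. *)
Lemma reduced_field (X : M -> 'rV[R]_(n.*2.+1)) (X_mu : Q -> 'rV[R]_(m.*2.+1)) (y : N) u :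
  hamiltonian_field SM eta H X -> hamiltonian_field SQ eta_mu reduced_hamiltonian X_mu ->
  mdiff SN SM set_val y u = X (set_val y) -> mdiff SN SQ pi y u = X_mu (pi y).
Proof.
move=> [_ [Rb RbP XE]] [_ [Rm RmP XmE]] uX.
have [X1 X2] := hamiltonian_fieldE RbP (XE (set_val y)).
have [Xm1 Xm2] := hamiltonian_fieldE RmP (XmE (pi y)).
have [smooth_mu nondeg] := eta_mu_contact.
pose W := mdiff SN SQ pi y u.
pose Z := W - X_mu (pi y).
pose r := fdiff SQ reduced_hamiltonian (pi y) (Rm (pi y)) - fdiff SM H (set_val y) (Rb (set_val y)).
have etaW : eta_mu (pi y) W = - H (set_val y) by rewrite eta_mu_pullback uX.
have etaZ : eta_mu (pi y) Z = 0.
  by rewrite /Z linearB/= etaW Xm1 reduced_hamiltonianE subrr.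
have extW w : ext_d SQ eta_mu (pi y) W w =
    fdiff SQ reduced_hamiltonian (pi y) w - fdiff SM H (set_val y) (Rb (set_val y)) * eta_mu (pi y) w.
  (* Every [w] lifts through the submersion to a vector [v] of the level, on whose image in M the
     equation of [X] can be evaluated. *)
  have [v <-] := SQ_quotient.2 y w.
  by rewrite ext_d_reduced uX X2 fdiff_reduced eta_mu_pullback.
have extZ w : ext_d SQ eta_mu (pi y) Z w = r * eta_mu (pi y) w.
  rewrite /Z -scaleN1r (ext_dDl smooth_mu) (ext_dZl smooth_mu) extW Xm2 /r.
  by rewrite mulN1r opprB addrC addrA subrK mulrBl.
have r0 : r = 0.
  have := extZ (Rm (pi y)); have [_ Rm1 Rm0] := RmP.
  by rewrite ext_dC Rm0 Rm1 oppr0 mulr1.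
have Z0 : Z = 0.
  apply: (contact_nondegenerate smooth_mu (nondeg (pi y)) etaZ) => w.
  by rewrite extZ r0 mul0r.
by apply/eqP; rewrite -subr_eq0 -/W -/Z Z0.
Qed.

End Reduction.

Theorem theorem19 (R : realType) (n : nat)
    (M : topologicalType) (SM : manifold_on R n.*2.+1 M)
    (eta : M -> {scalar 'rV[R]_(n.*2.+1)}) (H : M -> R)
    (sysM : contact_hamiltonian_system SM eta H)
    (d : nat) (G : lieGroup R d) (a : smooth_action G SM)
    (a_free : free_action a) (a_proper : proper_action a)
    (a_contact : by_contactomorphisms a eta)
    (H_inv : forall g x, H (act a g x) = H x)
    (mu : {scalar 'rV[R]_d})
    (mu_regular : regular_value SM (moment_map a eta) mu)
    (mu_fixed : forall g : G, coadjoint g mu = mu)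
    (* J^-1(mu) as an embedded submanifold of codimension d *)
    (SN : manifold_on R (n.*2.+1 - d) (moment_level a eta mu))
    (SN_sub : immersion SN SM set_val)
    (* M_mu = J^-1(mu) / G as the quotient manifold *)
    (m : nat)
    (SQ : manifold_on R m.*2.+1 (reduced_space a eta mu))
    (SQ_quotient : submersion SN SQ (reduced_proj a eta mu))
    (eta_mu : reduced_space a eta mu -> {scalar 'rV[R]_(m.*2.+1)})
    (eta_mu_contact : contact_form SQ eta_mu)
    (eta_mu_pullback : forall y v,
       eta_mu (reduced_proj a eta mu y) (mdiff SN SQ (reduced_proj a eta mu) y v)
       = eta (set_val y) (mdiff SN SM set_val y v)) :
  exists H_mu : reduced_space a eta mu -> R,
    [/\ H_mu \o reduced_proj a eta mu = H \o set_val,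
        contact_hamiltonian_system SQ eta_mu H_mu &
        forall X X_mu, hamiltonian_field SM eta H X ->
          hamiltonian_field SQ eta_mu H_mu X_mu ->
          (* Y is the restriction of X to J^-1(mu) *)
          exists Y : moment_level a eta mu -> 'rV[R]_(n.*2.+1 - d),
            [/\ smooth_vfield SN Y,
                forall y, mdiff SN SM set_val y (Y y) = X (set_val y) &
                forall y, mdiff SN SQ (reduced_proj a eta mu) y (Y y)
                          = X_mu (reduced_proj a eta mu y)]].
Proof.
have [[smooth_eta _] smooth_H] := sysM.
exists (@reduced_hamiltonian R n M SM eta H d G a mu); split.
- by apply/funext => y; exact: reduced_hamiltonianE.
- split=> //.
  exact: (smooth_reduced_hamiltonian smooth_H H_inv SN_sub SQ_quotient).
- move=> X X_mu XH XmuH.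
  have tangent y : exists u, mdiff SN SM set_val y u = X (set_val y).
    exact: (hamiltonian_field_tangent smooth_eta smooth_H a_contact H_inv
              mu_regular mu_fixed SN_sub SQ_quotient eta_mu_pullback).
  (* The preimages are chosen point by point; the immersion makes them unique, and
     [smooth_vfield_lift] shows that the resulting field is smooth. *)
  have [Y YE] := choice tangent.
  exists Y; split=> //.
    exact: (smooth_vfield_lift SN_sub XH.1 YE).
  move=> y.
  exact: (reduced_field smooth_eta smooth_H H_inv SN_sub SQ_quotient
            eta_mu_contact eta_mu_pullback XH XmuH (YE y)).
Qed.
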